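(* Let $A$ be a finite dimensional quasi-hereditary algebra over a field with a simple preserving duality. Then there exists a unique (up to isomorphism) minimal faithful basic tilting $A$-module $T$, in the sense that any other faithful tilting $A$-module $T'$ has $T$ as a direct summand (up to isomorphism).
   Context: Let $K$ be a field and $A$ a finite dimensional unital $K$-algebra; modules are finite dimensional left modules (category $A$-mod). $\{L(\lambda)\mid\lambda\in\Lambda^+\}$ is a complete set of representatives of isomorphism classes of simple $A$-modules, and $A$ is assumed split, i.e. $\operatorname{End}_A(L(\lambda))=K$. $P(\lambda)$, $I(\lambda)$ are the projective cover and injective hull of $L(\lambda)$; $\operatorname{Tr}_M(N)$ is the sum of the images of all homomorphisms $M\to N$. Quasi-hereditary: there is a partial order $\preceq$ on $\Lambda^+$ such that, with $\Delta(\lambda):=P(\lambda)/\operatorname{Tr}_{\bigoplus_{\mu\succ\lambda}P(\mu)}(P(\lambda))$, for each $\lambda$ the kernel of $P(\lambda)\twoheadrightarrow\Delta(\lambda)$ has a filtration with subquotients $\Delta(\mu)$, $\mu\succ\lambda$, and the kernel of $\Delta(\lambda)\twoheadrightarrow L(\lambda)$ has a filtration with subquotients $L(\mu)$, $\mu\prec\lambda$. The costandard module $\nabla(\lambda)$ is the largest submodule of $I(\lambda)$ with no composition factor $L(\mu)$, $\mu\succ\lambda$. $\mathcal{F}(\Delta)$ (resp. $\mathcal{F}(\nabla)$) is the full subcategory of modules having a filtration with all subquotients of the form $\Delta(\lambda)$ (resp. $\nabla(\lambda)$). A tilting module is an object of $\mathcal{F}(\Delta)\cap\mathcal{F}(\nabla)$.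 A tilting module is basic if it is a direct sum of pairwise non-isomorphic indecomposable tilting modules. Simple preserving duality: an exact, involutive, contravariant equivalence $A\text{-mod}\to A\text{-mod}$ which preserves the isomorphism classes of simple modules. *)

(* Defs.v *)
From HB Require Import structures.
From mathcomp Require Import all_boot all_order all_algebra all_field.
From mathcomp Require Import boolp classical_sets.

Set Implicit Arguments.
Unset Strict Implicit.
Unset Printing Implicit Defensive.

Import Order.TTheory GRing.Theory.
Local Open Scope ring_scope.

Section SumFamily.
Variables (K : fieldType) (V : vectType K).
Implicit Types (F : {vspace V} -> Prop) (U W : {vspace V}).

Definition is_sumv_family F U : Prop :=
  (forall W, F W -> (W <= U)%VS) /\
  (forall U', (forall W, F W -> (W <= U')%VS) -> (U <= U')%VS).

(* The default value 0 is never used, by [sumv_familyP]. *)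
Definition sumv_family F : {vspace V} := xget 0%VS (is_sumv_family F).

Lemma sumv_familyP F : is_sumv_family F (sumv_family F).
Proof.
rewrite /sumv_family; apply: (@xgetPex _ _ (is_sumv_family F)).
pose P n := `[< exists2 s : seq {vspace V}, (forall W, W \in s -> F W)
                & \dim (\sum_(W <- s) W)%VS = n >].
have P0 : exists n, P n.
  by exists (\dim (\sum_(W <- [::]) W : {vspace V})%VS); apply/asboolP; exists [::].
have Pb n : P n -> (n <= \dim {:V})%N.
  by move=> /asboolP[s _ <-]; apply/dimvS/subvf.
case: (ex_maxnP P0 Pb) => n /asboolP[s sF dims] maxn.
exists (\sum_(W <- s) W)%VS; split=> [W FW | U' ubU'].
  have /maxn : P (\dim (\sum_(X <- W :: s) X)%VS).
    apply/asboolP; exists (W :: s) => // X.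
    by rewrite inE => /orP[/eqP-> // | /sF].
  rewrite big_cons -dims => le_dim.
  have sub : (\sum_(X <- s) X <= W + \sum_(X <- s) X)%VS by exact: addvSr.
  have /eqP-> : (\sum_(X <- s) X == W + \sum_(X <- s) X)%VS.
    by rewrite eqEdim sub le_dim.
  exact: addvSl.
elim: s {dims} sF => [|X s IHs] sF; first by rewrite big_nil sub0v.
rewrite big_cons subv_add ubU' ?IHs // => [W Ws|]; apply: sF.
  by rewrite inE Ws orbT.
by rewrite inE eqxx.
Qed.

End SumFamily.

Section Modules.
Variables (K : fieldType) (A : falgType K).

Record fdmod := FdMod {
  carrier :> vectType K;
  act : {linear A -> 'End(carrier)};
  act1 : forall x, act 1 x = x;
  actM : forall a b x, act (a * b) x = act a (act b x) }.

Implicit Types M N X Y S : fdmod.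

Record modhom M N := ModHom {
  hom_fun :> 'Hom(M, N);
  homP : forall a x, hom_fun (act M a x) = act N a (hom_fun x) }.

Lemma id_hom_subproof M a x : (\1%VF : 'End(M)) (act M a x) = act M a (\1%VF x).
Proof. by rewrite !id_lfunE. Qed.
Definition id_hom M : modhom M M := ModHom (@id_hom_subproof M).

Lemma comp_hom_subproof M N X (g : modhom N X) (f : modhom M N) a x :
  (hom_fun g \o hom_fun f)%VF (act M a x) = act X a ((hom_fun g \o hom_fun f)%VF x).
Proof. by rewrite !comp_lfunE !homP. Qed.
Definition comp_hom M N X (g : modhom N X) (f : modhom M N) : modhom M X :=
  ModHom (comp_hom_subproof g f).

Definition injective_hom M N (f : modhom M N) : Prop := lker f = 0%VS.
Definition surjective_hom M N (f : modhom M N) : Prop := limg f = fullv.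
Definition iso_hom M N (f : modhom M N) : Prop :=
  injective_hom f /\ surjective_hom f.
Definition iso M N : Prop := exists f : modhom M N, iso_hom f.

Record submod M := Submod {
  submod_space :> {vspace M};
  submodP : forall a x, x \in submod_space -> act M a x \in submod_space }.

Lemma zero_submod_subproof M a x :
  x \in (0%VS : {vspace M}) -> act M a x \in (0%VS : {vspace M}).
Proof. by rewrite !memv0 => /eqP->; rewrite linear0 eqxx. Qed.
Definition zero_submod M : submod M := Submod (@zero_submod_subproof M).

Lemma full_submod_subproof M a x :
  x \in (fullv : {vspace M}) -> act M a x \in (fullv : {vspace M}).
Proof. by move=> _; exact: memvf. Qed.
Definition full_submod M : submod M := Submod (@full_submod_subproof M).

Lemma hker_subproof M N (f : modhom M N) a x :
  x \in lker f -> act M a x \in lker f.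
Proof. by rewrite !memv_ker homP => /eqP->; rewrite linear0. Qed.
Definition hker M N (f : modhom M N) : submod M := Submod (@hker_subproof M N f).

(* [subquot W U] is the module W / (W :&: U), that is W / U when U <= W.  It is
   realised on the complement [W :\: U] of [W :&: U] in W, on which a acts by
   the action of a followed by the projection along U. *)
Section Subquotient.
Variables (M : fdmod) (W U : submod M).

Let C : {vspace M} := (W :\: U)%VS.
Let p : 'End(M) := addv_pi1 W U.

Let pC x : p x \in C.
Proof. exact: memv_pi. Qed.

Let pU x : x \in submod_space U -> p x = 0.
Proof.
move=> xU; have := addv_pi1_pi2 (subvP (addvSr W U) _ xU).
by rewrite addv_pi2_id // => /(canRL (addrK _)); rewrite subrr.
Qed.

Let p_id x : x \in C -> p x = x.
Proof. by apply: daddv_pi_id; exact: capv_diff. Qed.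

Let p_eq x : x \in submod_space W -> exists2 u, u \in submod_space U & x = p x + u.
Proof.
move=> xW; exists (addv_pi2 W U x); first exact: memv_pi2.
by rewrite addv_pi1_pi2 // (subvP (addvSl _ _)).
Qed.

Let CW x : x \in C -> x \in submod_space W.
Proof. by apply: subvP; exact: diffvSl. Qed.

Let pact x a : x \in submod_space W -> p (act M a (p x)) = p (act M a x).
Proof.
move=> /p_eq[u uU {2}->]; rewrite linearD linearD /=.
by rewrite (pU (submodP a uU)) addr0.
Qed.

Definition sq_fun a (x : subvs_of C) : subvs_of C := vsproj C (p (act M a (vsval x))).

Lemma sq_fun_linear a : linear (sq_fun a).
Proof. by move=> k x y; rewrite /sq_fun !linearP. Qed.

HB.instance Definition _ a :=
  GRing.isSemilinear.Build K (subvs_of C) (subvs_of C) _ (sq_fun a)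
    (GRing.semilinear_linear (sq_fun_linear a)).

Definition sq_act a : 'End(subvs_of C) := linfun (sq_fun a).

Lemma sq_actE a x : vsval (sq_act a x) = p (act M a (vsval x)).
Proof. by rewrite lfunE /= vsprojK. Qed.

Lemma sq_act_linear : linear sq_act.
Proof.
move=> k a b; apply/lfunP=> x; rewrite add_lfunE scale_lfunE; apply: val_inj.
transitivity (p (act M (k *: a + b) (vsval x))); first exact: sq_actE.
transitivity (k *: vsval (sq_act a x) + vsval (sq_act b x)); last first.
  by rewrite -[RHS]/(vsval _) linearP.
by rewrite !sq_actE (linearP (act M)) add_lfunE scale_lfunE (linearP p).
Qed.

HB.instance Definition _ :=
  GRing.isSemilinear.Build K A 'End(subvs_of C) _ sq_act
    (GRing.semilinear_linear sq_act_linear).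

Lemma sq_act1 x : sq_act 1 x = x.
Proof.
by apply: val_inj; rewrite -[LHS]/(vsval _) sq_actE act1 p_id ?subvsP.
Qed.

Lemma sq_actM a b x : sq_act (a * b) x = sq_act a (sq_act b x).
Proof.
apply: val_inj; rewrite -[LHS]/(vsval _) -[RHS]/(vsval _) !sq_actE actM pact //.
by apply/submodP/CW/subvsP.
Qed.

Definition subquot : fdmod :=
  @FdMod (subvs_of C) sq_act sq_act1 sq_actM.

Definition subquot_proj_fun : 'Hom(M, subquot) := linfun (vsproj C \o p).

Lemma subquot_proj_act a x : x \in submod_space W ->
  subquot_proj_fun (act M a x) = act subquot a (subquot_proj_fun x).
Proof.
move=> xW; apply: val_inj; rewrite -[RHS]/(vsval (sq_act _ _)) sq_actE !lfunE /=.
by rewrite !vsprojK ?pC // pact.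
Qed.

End Subquotient.

Definition quot M (U : submod M) : fdmod := subquot (full_submod M) U.

Lemma quot_proj_subproof M (U : submod M) a x :
  subquot_proj_fun (full_submod M) U (act M a x) =
  act (quot U) a (subquot_proj_fun (full_submod M) U x).
Proof. by apply: subquot_proj_act; exact: memvf. Qed.
Definition quot_proj M (U : submod M) : modhom M (quot U) :=
  ModHom (quot_proj_subproof U).

Definition submod_mod M (U : submod M) : fdmod := subquot U (zero_submod M).

Definition zero_vect : vectType K := 'rV[K]_0.
Definition zero_act (a : A) : 'End(zero_vect) := 0.
Lemma zero_act_linear : linear zero_act.
Proof. by move=> k a b; rewrite /zero_act scaler0 addr0. Qed.
HB.instance Definition _ :=
  GRing.isSemilinear.Build K A 'End(zero_vect) _ zero_act
    (GRing.semilinear_linear zero_act_linear).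
Lemma zero_act1 (x : zero_vect) : zero_act 1 x = x.
Proof. by apply/rowP=> -[]. Qed.
Lemma zero_actM a b (x : zero_vect) : zero_act (a * b) x = zero_act a (zero_act b x).
Proof. by apply/rowP=> -[]. Qed.
Definition zero_mod : fdmod := @FdMod zero_vect zero_act zero_act1 zero_actM.

Section DirectSum.
Variables M N : fdmod.

Definition ds_fun a (x : (M * N)%type) : (M * N)%type := (act M a x.1, act N a x.2).

Lemma ds_fun_linear a : linear (ds_fun a).
Proof. by move=> k x y; rewrite /ds_fun /= !linearP. Qed.

HB.instance Definition _ a :=
  GRing.isSemilinear.Build K (M * N)%type (M * N)%type _ (ds_fun a)
    (GRing.semilinear_linear (ds_fun_linear a)).

Definition ds_act a : 'End((M * N)%type) := linfun (ds_fun a).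

Lemma ds_act_linear : linear ds_act.
Proof.
move=> k a b; apply/lfunP=> x; rewrite add_lfunE scale_lfunE !lfunE /= /ds_fun.
by rewrite !linearP /= !(add_lfunE, scale_lfunE).
Qed.

HB.instance Definition _ :=
  GRing.isSemilinear.Build K A 'End((M * N)%type) _ ds_act
    (GRing.semilinear_linear ds_act_linear).

Lemma ds_act1 x : ds_act 1 x = x.
Proof. by rewrite lfunE /= /ds_fun !act1; case: x. Qed.

Lemma ds_actM a b x : ds_act (a * b) x = ds_act a (ds_act b x).
Proof. by rewrite !lfunE /= /ds_fun !actM. Qed.

Definition dsum : fdmod := @FdMod (M * N)%type ds_act ds_act1 ds_actM.

End DirectSum.

Definition direct_summand M N : Prop := exists X, iso N (dsum M X).

Definition nonzero M : Prop := (fullv : {vspace M}) <> 0%VS.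

Definition simple M : Prop :=
  nonzero M /\
  forall U : submod M, (U : {vspace M}) = 0%VS \/ (U : {vspace M}) = fullv.

Definition indecomposable M : Prop :=
  nonzero M /\ forall X Y, iso M (dsum X Y) -> ~ nonzero X \/ ~ nonzero Y.

Definition faithful M : Prop := forall a, (forall x, act M a x = 0) -> a = 0.

Definition projective P : Prop :=
  forall X Y (g : modhom X Y) (h : modhom P Y), surjective_hom g ->
  exists h' : modhom P X, comp_hom g h' = h.

Definition injective_mod I : Prop :=
  forall X Y (g : modhom X Y) (h : modhom X I), injective_hom g ->
  exists h' : modhom Y I, comp_hom h' g = h.

Definition projective_cover P M (p : modhom P M) : Prop :=
  [/\ projective P, surjective_hom p &
      forall U : submod P, (U + lker p)%VS = fullv -> (U : {vspace P}) = fullv].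

Definition injective_hull M I (i : modhom M I) : Prop :=
  [/\ injective_mod I, injective_hom i &
      forall U : submod I, (U :&: limg i)%VS = 0%VS -> (U : {vspace I}) = 0%VS].

Lemma trace_subproof M N a x :
  let T := sumv_family (fun W => exists f : modhom M N, W = limg f) in
  x \in T -> act N a x \in T.
Proof.
move=> T xT; have [ub least] := sumv_familyP (fun W => exists f : modhom M N, W = limg f).
suff /subvP/(_ _ xT) : (T <= act N a @^-1: T)%VS by rewrite memv_preim.
apply: least => _ [f ->]; apply/subvP=> _ /memv_imgP[y _ ->].
rewrite -memv_preim -homP; apply: (subvP (ub (limg f) _)); first by exists f.
exact: memv_img (memvf _).
Qed.
(* This is Tr_M(N): M is the source, N the module containing the trace. *)
Definition trace M N : submod N := Submod (@trace_subproof M N).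

Definition filtration M (V : submod M) (n : nat) (F : nat -> submod M) : Prop :=
  [/\ (F 0%N : {vspace M}) = 0%VS, (F n : {vspace M}) = V &
      forall i, (i < n)%N -> (F i <= F i.+1)%VS].

Definition filtered_by (I : Type) (S : I -> fdmod) (J : pred I)
    M (V : submod M) : Prop :=
  exists n F, filtration V n F /\
    forall k, (k < n)%N ->
      exists2 i, J i & iso (subquot (F k.+1) (F k)) (S i).

Definition composition_factor M (V : submod M) S : Prop :=
  exists n F, [/\ filtration V n F,
    forall k, (k < n)%N -> simple (subquot (F k.+1) (F k)) &
    exists2 k, (k < n)%N & iso (subquot (F k.+1) (F k)) S].

Definition simples_representatives (Lam : Type) (L : Lam -> fdmod) : Prop :=
  [/\ forall l, simple (L l),
      forall S, simple S -> exists l, iso S (L l) &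
      forall l m, iso (L l) (L m) -> l = m].

Definition split_simples (Lam : Type) (L : Lam -> fdmod) : Prop :=
  forall l (f : modhom (L l) (L l)), exists k : K, forall x, f x = k *: x.

Record cofunctor := Cofunctor {
  cobj :> fdmod -> fdmod;
  cmap : forall M N, modhom M N -> modhom (cobj N) (cobj M);
  cmap_id : forall M, cmap (id_hom M) = id_hom (cobj M);
  cmap_comp : forall M N X (g : modhom N X) (f : modhom M N),
    cmap (comp_hom g f) = comp_hom (cmap f) (cmap g) }.

Definition short_exact X Y Z (f : modhom X Y) (g : modhom Y Z) : Prop :=
  [/\ injective_hom f, limg f = lker g & surjective_hom g].

Definition exact_cofunctor (D : cofunctor) : Prop :=
  forall X Y Z (f : modhom X Y) (g : modhom Y Z),
  short_exact f g -> short_exact (cmap D g) (cmap D f).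

Definition coequivalence (D : cofunctor) : Prop :=
  [/\ forall M N (f g : modhom M N), cmap D f = cmap D g -> f = g,
      forall M N (h : modhom (D N) (D M)), exists f : modhom M N, cmap D f = h &
      forall M, exists N, iso M (D N)].

Definition involutive_cofunctor (D : cofunctor) : Prop :=
  exists eta : forall M, modhom M (D (D M)),
    (forall M, iso_hom (eta M)) /\
    (forall M N (f : modhom M N),
       comp_hom (eta N) f = comp_hom (cmap D (cmap D f)) (eta M)).

Definition simple_preserving_duality (D : cofunctor) : Prop :=
  [/\ exact_cofunctor D, coequivalence D, involutive_cofunctor D &
      forall S, simple S -> iso (D S) S].

Section QuasiHereditary.
Variables (d : Order.disp_t) (Lam : finPOrderType d).
Variable L : Lam -> fdmod.

Definition std_kernel (P : Lam -> fdmod) (l : Lam) : submod (P l) :=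
  trace (\big[dsum/zero_mod]_(m | (l < m)%O) P m) (P l).

Definition std (P : Lam -> fdmod) (l : Lam) : fdmod := quot (std_kernel P l).

Definition quasi_hereditary (P : Lam -> fdmod) (p : forall l, modhom (P l) (L l)) :
    Prop :=
  forall l,
    filtered_by (std P) (fun m => (l < m)%O) (hker (quot_proj (std_kernel P l))) /\
    exists2 q : modhom (std P l) (L l),
      comp_hom q (quot_proj (std_kernel P l)) = p l &
      filtered_by L (fun m => (m < l)%O) (hker q).

Definition no_larger_factor (I : fdmod) (l : Lam) (U : submod I) : Prop :=
  forall m, (l < m)%O -> ~ composition_factor U (L m).

(* For I the injective hull of L(l), U is the costandard module inside I. *)
Definition is_costd (I : fdmod) (l : Lam) (U : submod I) : Prop :=
  no_larger_factor l U /\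
  forall W : submod I, no_larger_factor l W -> (W <= U)%VS.

End QuasiHereditary.

Section Tilting.
Variables (Lam : Type) (Delta Nabla : Lam -> fdmod).

Definition tilting M : Prop :=
  filtered_by Delta xpredT (full_submod M) /\
  filtered_by Nabla xpredT (full_submod M).

Definition basic_tilting M : Prop :=
  exists n (X : 'I_n -> fdmod),
    [/\ iso M (\big[dsum/zero_mod]_(i < n) X i),
        forall i, indecomposable (X i) /\ tilting (X i) &
        forall i j, iso (X i) (X j) -> i = j].

Definition minimal_faithful_basic_tilting T : Prop :=
  [/\ basic_tilting T, tilting T, faithful T &
      forall T', tilting T' -> faithful T' -> direct_summand T T'].

End Tilting.

End Modules.

(* Main.v *)
(* With D the duality, D (Delta l) is the costandard module of l, so M is tilting
   exactly when M and D M are both in F(Delta); since D preserves composition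
   factors, an indecomposable tilting module is self-dual.

   Let f : A -> T0 be of minimal dimension among the embeddings into a tilting
   module along which all maps from A to tilting modules extend, and whose image
   is the kernel of a map g from T0 to a tilting module.  By minimality, an
   indecomposable summand X of T0 is not the image of a map Y -> X, Y tilting,
   that is not a split epimorphism.  Dually, some t <> 0 in X is killed by every
   map from X to a tilting module that is not a split monomorphism.  The
   restriction of g to X is such a map, so t = f a for some a in A, a <> 0.  A map
   from A to an indecomposable tilting module Y extends to T0 and so kills a
   unless Y is isomorphic to X.  Hence X is a summand of every faithful tilting
   module, and the sum of the distinct summands of T0 is the module sought. *)

Require Import Defs.
From HB Require Import structures.
From mathcomp Require Import all_boot all_order all_algebra all_field.
From mathcomp Require Import boolp.

Set Implicit Arguments.
Unset Strict Implicit.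
Unset Printing Implicit Defensive.

Import Order.TTheory GRing.Theory.

(** * Homomorphisms, subquotients and direct sums *)

Section Toolkit.
Local Open Scope ring_scope.
Variables (K : fieldType) (A : falgType K).
Implicit Types M N X Y Z : fdmod A.

(** The homological input is the vanishing of Ext^1 from F(Delta) to D F(Delta). Through it, maps to
    tilting modules extend along any embedding with cokernel in F(Delta); and iterated universal
    extensions by the Delta l embed every module of F(Delta) in a tilting module with such a
    cokernel. As A lies in F(Delta), embedding A, and then the cokernel, gives f and g.

    Minimality of T0 acts through one consequence: a retraction of T0 onto a nonzero module never
    vanishes on f(A). Suppose psi : Y -> X were onto and not split. A lift to Y of A -> T0 -> X
    extends along f to T0, so T0 -> X differs from a map through psi by a map vanishing on f(A). As
    End(X) is local, one of the two splits, and neither may. A retraction of g restricted to X is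
    excluded in the same way.

    The element t comes from the fact that non-split maps from tilting modules to X have a largest
    image, a proper submodule: the dual of its cokernel is a nonzero submodule of D X, which is
    isomorphic to X. *)

Lemma hom_ext M N (f g : modhom M N) : (forall x, f x = g x) -> f = g.
Proof.
case: f g => [f Hf] [g Hg] /= /lfunP E; rewrite E in Hf *.
by congr ModHom; apply: Prop_irrelevance.
Qed.

Lemma homD M N (f : modhom M N) x y : f (x + y) = f x + f y.
Proof. exact: linearD. Qed.

Lemma homB M N (f : modhom M N) x y : f (x - y) = f x - f y.
Proof. exact: linearB. Qed.

Lemma hom0 M N (f : modhom M N) : f 0 = 0.
Proof. exact: linear0. Qed.

Lemma comp_homE M N X (g : modhom N X) (f : modhom M N) x :
  comp_hom g f x = g (f x).
Proof. by rewrite comp_lfunE. Qed.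

Lemma id_homE M (x : M) : id_hom M x = x.
Proof. by rewrite id_lfunE. Qed.

Section MkHom.
Variables (M N : fdmod A) (f : M -> N).
Hypothesis lin_f : linear f.
Hypothesis act_f : forall a x, f (act M a x) = act N a (f x).

Lemma hom_of_fun : exists h : modhom M N, forall x, h x = f x.
Proof.
pose F : {linear M -> N} :=
  HB.pack f (GRing.isSemilinear.Build K M N _ f (GRing.semilinear_linear lin_f)).
have FE x : linfun F x = f x by rewrite lfunE.
have Fact a x : linfun F (act M a x) = act N a (linfun F x) by rewrite !FE act_f.
by exists (ModHom Fact) => x; rewrite /= FE.
Qed.

Definition mkhom : modhom M N := sval (cid hom_of_fun).

Lemma mkhomE x : mkhom x = f x.
Proof. exact: (svalP (cid hom_of_fun)). Qed.

End MkHom.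

Lemma hom_zero_linear M N : linear (fun _ : M => 0 : N).
Proof. by move=> k x y; rewrite scaler0 addr0. Qed.
Lemma hom_zero_act M N a (x : M) : (0 : N) = act N a 0.
Proof. by rewrite linear0. Qed.
Definition hom_zero M N : modhom M N :=
  mkhom (@hom_zero_linear M N) (@hom_zero_act M N).
Lemma hom_zeroE M N x : hom_zero M N x = 0.
Proof. exact: mkhomE. Qed.

Lemma hom_comb_subproof M N (k : K) (f g : modhom M N) a x :
  (k *: hom_fun f + hom_fun g) (act M a x) = act N a ((k *: hom_fun f + hom_fun g) x).
Proof. by rewrite !(add_lfunE, scale_lfunE) !homP linearP. Qed.
Definition hom_comb M N (k : K) (f g : modhom M N) : modhom M N :=
  ModHom (@hom_comb_subproof M N k f g).
Lemma hom_combE M N k (f g : modhom M N) x : hom_comb k f g x = k *: f x + g x.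
Proof. by rewrite !(add_lfunE, scale_lfunE). Qed.

Definition hom_sub M N (f g : modhom M N) : modhom M N := hom_comb (-1) g f.
Lemma hom_subE M N (f g : modhom M N) x : hom_sub f g x = f x - g x.
Proof. by rewrite hom_combE scaleN1r addrC. Qed.

(** Elementwise forms of the notions that the statement phrases with kernels and images as
    subspaces; [sesP] translates. *)
Definition minj M N (f : modhom M N) := forall x, f x = 0 -> x = 0.
Definition msurj M N (f : modhom M N) := forall y, exists x, f x = y.
Definition kerim X M Z (f : modhom X M) (g : modhom M Z) :=
  forall y, g y = 0 <-> exists x, f x = y.
Definition ses X M Z (f : modhom X M) (g : modhom M Z) :=
  [/\ minj f, kerim f g & msurj g].

Lemma minjP M N (f : modhom M N) : minj f <-> injective_hom f.
Proof.
split=> [f0|f0 x fx]; last first.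
  by apply/eqP; rewrite -memv0 -[0%VS](f0 : lker f = _) memv_ker fx.
apply/eqP; rewrite -subv0; apply/subvP=> x.
by rewrite memv_ker memv0 => /eqP/f0->.
Qed.

Lemma minj_inj M N (f : modhom M N) : minj f -> injective f.
Proof.
move=> f0 x y fxy; apply/eqP; rewrite -subr_eq0; apply/eqP/f0.
by rewrite linearB /= fxy subrr.
Qed.

Lemma msurjP M N (f : modhom M N) : msurj f <-> surjective_hom f.
Proof.
split=> [fs|fs y].
  by apply/vspaceP=> y; rewrite memvf; case: (fs y) => x <-; rewrite memv_img ?memvf.
have : y \in limg f by rewrite fs memvf.
by case/memv_imgP=> x _ ->; exists x.
Qed.

Lemma kerimP X M Z (f : modhom X M) (g : modhom M Z) : kerim f g <-> limg f = lker g.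
Proof.
split=> [fg|fg y].
  apply/vspaceP=> y; rewrite memv_ker; apply/memv_imgP/eqP.
    by case=> x _ ->; apply/fg; exists x.
  by case/fg=> x <-; exists x; rewrite ?memvf.
split=> [/eqP|[x <-]].
  by rewrite -memv_ker -fg => /memv_imgP[x _ ->]; exists x.
by apply/eqP; rewrite -memv_ker -fg memv_img ?memvf.
Qed.

Lemma sesP X M Z (f : modhom X M) (g : modhom M Z) : ses f g <-> short_exact f g.
Proof. by split=> -[/minjP ? /kerimP ? /msurjP ?]. Qed.

(** The universal property of a quotient. The section [s] of g is only set-theoretic; the hypothesis
    on kernels makes [h (s y)] independent of its choice, hence linear and equivariant. *)
Lemma factor_surj M N X (g : modhom M N) (h : modhom M X) :
  msurj g -> (forall x, g x = 0 -> h x = 0) ->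
  exists h' : modhom N X, forall x, h' (g x) = h x.
Proof.
move=> gs gh; have [s sK] := choice gs.
have hE x y : g x = g y -> h x = h y.
  by move=> e; apply/eqP; rewrite -subr_eq0 -linearB; apply/eqP/gh; rewrite linearB /= e subrr.
have ls : linear (fun y => h (s y)).
  by move=> k x y; rewrite -linearP; apply: hE; rewrite linearP /= !sK.
have as_ a y : h (s (act N a y)) = act X a (h (s y)).
  by rewrite -homP; apply: hE; rewrite homP !sK.
by exists (mkhom ls as_) => x; rewrite mkhomE; apply: hE; rewrite sK.
Qed.

Lemma factor_inj M N X (i : modhom N M) (h : modhom X M) :
  minj i -> (forall x, exists y, i y = h x) ->
  exists h' : modhom X N, forall x, i (h' x) = h x.
Proof.
move=> /minj_inj ii /choice[s sK].
have ls : linear s by move=> k x y; apply: ii; rewrite linearP /= !sK linearP.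
have as_ a y : s (act X a y) = act N a (s y) by apply: ii; rewrite homP !sK homP.
by exists (mkhom ls as_) => x; rewrite mkhomE sK.
Qed.

Lemma isoP M N : iso M N <-> exists (f : modhom M N) (g : modhom N M),
  (forall x, g (f x) = x) /\ (forall y, f (g y) = y).
Proof.
split=> [[f [/minjP fi /msurjP fs]]|[f [g [fK gK]]]].
  have [|g gK] := @factor_surj _ _ _ f (id_hom M) fs; first by move=> x /fi->; rewrite linear0.
  have gK' x : g (f x) = x by rewrite gK id_homE.
  by exists f, g; split=> // y; case: (fs y) => x <-; rewrite gK'.
exists f; split; first by apply/minjP=> x fx; rewrite -(fK x) fx linear0.
by apply/msurjP=> y; exists (g y).
Qed.

Lemma bij_iso M N (f : modhom M N) : minj f -> msurj f -> iso M N.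
Proof. by exists f; split; [apply/minjP|apply/msurjP]. Qed.

Lemma iso_bij M N : iso M N -> exists f : modhom M N, minj f /\ msurj f.
Proof. by case=> f [/minjP ? /msurjP ?]; exists f. Qed.

Lemma iso_refl M : iso M M.
Proof. by apply: (@bij_iso _ _ (id_hom M)) => x; rewrite ?id_homE //; exists x; rewrite id_homE. Qed.

Lemma iso_sym M N : iso M N -> iso N M.
Proof. by case/isoP=> f [g [? ?]]; apply/isoP; exists g, f. Qed.

Lemma iso_trans M N X : iso M N -> iso N X -> iso M X.
Proof.
move=> /isoP[f [g [fK gK]]] /isoP[f' [g' [fK' gK']]]; apply/isoP.
by exists (comp_hom f' f), (comp_hom g g'); split=> x; rewrite !comp_homE ?fK' // gK.
Qed.

Lemma subquot_proj_surj M (W U : submod M) (y : subquot W U) :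
  exists2 x, x \in submod_space W & subquot_proj_fun W U x = y.
Proof.
exists (vsval y); first exact: (subvP (diffvSl _ _) _ (subvsP y)).
apply: val_inj; rewrite -[LHS]/(vsval _) lfunE /= vsprojK ?memv_pi //.
apply: daddv_pi_id; [exact: capv_diff | exact: subvsP].
Qed.

Lemma subquot_proj_ker M (W U : submod M) x : x \in submod_space W ->
  subquot_proj_fun W U x = 0 <-> x \in submod_space U.
Proof.
move=> xW; have xWU := subvP (addvSl W U) _ xW.
have xE := addv_pi1_pi2 xWU.
have vE : vsval (subquot_proj_fun W U x) = addv_pi1 W U x.
  by rewrite lfunE /= vsprojK ?memv_pi.
split=> [y0|xU].
  by rewrite -xE -vE y0 linear0 add0r memv_pi2.
apply: val_inj; rewrite -[LHS]/(vsval _) vE -[RHS]/(vsval _) linear0.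
by move: xE; rewrite addv_pi2_id // => /(canRL (addrK _)); rewrite subrr.
Qed.

(** Presents W / U as a quotient of any module N with image W in M, so that the realisation of
    [subquot] on a complement can be forgotten from here on. *)
Lemma subquotP M (W U : submod M) N (i : modhom N M) :
  (forall x, x \in submod_space W <-> exists y, i y = x) ->
  exists s : modhom N (subquot W U), msurj s /\
    forall y, s y = 0 <-> i y \in submod_space U.
Proof.
move=> Wi; have iW y : i y \in submod_space W by apply/Wi; exists y.
have sa a y : (subquot_proj_fun W U \o i)%VF (act N a y) =
   act (subquot W U) a ((subquot_proj_fun W U \o i)%VF y).
  by rewrite !comp_lfunE homP subquot_proj_act.
exists (ModHom sa); split=> y; rewrite ?comp_lfunE; last exact: subquot_proj_ker.
by have [_ /Wi[x <-] <-] := subquot_proj_surj y; exists x; rewrite comp_lfunE.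
Qed.

(** The carrier is the complement of 0 in S, that is S itself, and the projection along 0 is the
    identity there; so the value map is an equivariant inclusion. *)
Lemma submod_modP M (S : submod M) : exists i : modhom (submod_mod S) M,
  minj i /\ forall x, x \in submod_space S <-> exists y, i y = x.
Proof.
pose C := (submod_space S :\: 0)%VS.
have CS : C = submod_space S by rewrite /C -[RHS](addv_diff_cap _ 0%VS) capv0 addv0.
have CleS : (C <= submod_space S)%VS by rewrite CS.
have pid x : x \in submod_space S -> addv_pi1 S (zero_submod M) x = x.
  move=> xS; have := addv_pi1_pi2 (subvP (addvSl S (zero_submod M)) _ xS).
  have : addv_pi2 S (zero_submod M) x \in (0%VS : {vspace M}).
    by apply: memv_pi2; rewrite (subvP (addvSl _ _)).
  by rewrite memv0 => /eqP->; rewrite addr0.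
pose v : subvs_of C -> M := vsval.
have lv : linear v by move=> k x y; rewrite /v linearP.
have av a (x : submod_mod S) : v (act (submod_mod S) a x) = act M a (v x).
  rewrite -[LHS]/(vsval (sq_act _ _ a x)) sq_actE pid //.
  by apply/submodP/(subvP CleS)/subvsP.
exists (@mkhom (submod_mod S) M v lv av); split=> x.
  by rewrite mkhomE => /eqP vx0; apply/eqP; move: vx0; rewrite -val_eqE.
split=> [xS|[y <-]]; last by rewrite mkhomE; apply/(subvP CleS)/subvsP.
by exists (vsproj C x); rewrite mkhomE /v vsprojK // CS.
Qed.

Lemma quot_projP M (S : submod M) : msurj (quot_proj S) /\
  forall x, quot_proj S x = 0 <-> x \in submod_space S.
Proof.
split=> [y|x]; last by apply: subquot_proj_ker; exact: memvf.
by have [x _ <-] := subquot_proj_surj y; exists x.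
Qed.

Lemma himg_subproof M N (f : modhom M N) a x : x \in limg f -> act N a x \in limg f.
Proof. by case/memv_imgP=> y _ ->; rewrite -homP memv_img ?memvf. Qed.
Definition himg M N (f : modhom M N) : submod N := Submod (@himg_subproof M N f).

Lemma himgP M N (f : modhom M N) x : x \in submod_space (himg f) <-> exists y, f y = x.
Proof.
split=> [/memv_imgP[y _ ->]|[y <-]]; first by exists y.
by rewrite /= memv_img ?memvf.
Qed.

Lemma hkerP M N (f : modhom M N) x : x \in submod_space (hker f) <-> f x = 0.
Proof. by rewrite /= memv_ker; split=> /eqP. Qed.

Lemma ex_coker X M (f : modhom X M) :
  exists Z (g : modhom M Z), msurj g /\ kerim f g.
Proof.
have [qs qk] := quot_projP (himg f); exists (quot (himg f)), (quot_proj _).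
by split=> // y; rewrite qk; exact: himgP.
Qed.

Lemma ex_ker M Z (g : modhom M Z) :
  exists X (f : modhom X M), minj f /\ kerim f g.
Proof.
have [i [ii ik]] := submod_modP (hker g); exists (submod_mod (hker g)), i.
by split=> // y; rewrite -hkerP.
Qed.

Lemma ex_img X M (f : modhom X M) : exists Y (s : modhom X Y) (i : modhom Y M),
  [/\ msurj s, minj i & forall x, i (s x) = f x].
Proof.
have [i [ii ik]] := submod_modP (himg f); exists (submod_mod (himg f)).
have [|s sE] := @factor_inj _ _ _ i f ii.
  by move=> x; apply/ik/himgP; exists x.
exists s, i; split=> // y.
have /himgP[x xE] : i y \in submod_space (himg f) by apply/ik; exists y.
by exists x; apply: (minj_inj ii); rewrite sE.
Qed.

Section DirectSums.
Variables M N : fdmod A.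

Lemma dsE a (x : dsum M N) : act (dsum M N) a x = (act M a x.1, act N a x.2).
Proof. by rewrite lfunE. Qed.

Lemma ds1_linear : linear (fun x : M => (x, 0) : dsum M N).
Proof. by move=> k x y; apply/eqP; rewrite xpair_eqE /= scaler0 addr0 !eqxx. Qed.
Lemma ds1_act a x : ((act M a x, 0) : dsum M N) = act (dsum M N) a (x, 0).
Proof. by rewrite dsE /= linear0. Qed.
Definition ds1 : modhom M (dsum M N) := mkhom ds1_linear ds1_act.
Lemma ds1E x : ds1 x = (x, 0). Proof. exact: mkhomE. Qed.

Lemma ds2_linear : linear (fun x : N => (0, x) : dsum M N).
Proof. by move=> k x y; apply/eqP; rewrite xpair_eqE /= scaler0 addr0 !eqxx. Qed.
Lemma ds2_act a x : ((0, act N a x) : dsum M N) = act (dsum M N) a (0, x).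
Proof. by rewrite dsE /= linear0. Qed.
Definition ds2 : modhom N (dsum M N) := mkhom ds2_linear ds2_act.
Lemma ds2E x : ds2 x = (0, x). Proof. exact: mkhomE. Qed.

Lemma pr1_linear : linear (fun x : dsum M N => x.1). Proof. by []. Qed.
Lemma pr1_act a (x : dsum M N) : (act (dsum M N) a x).1 = act M a x.1.
Proof. by rewrite dsE. Qed.
Definition pr1 : modhom (dsum M N) M := mkhom pr1_linear pr1_act.
Lemma pr1E x : pr1 x = x.1. Proof. exact: mkhomE. Qed.

Lemma pr2_linear : linear (fun x : dsum M N => x.2). Proof. by []. Qed.
Lemma pr2_act a (x : dsum M N) : (act (dsum M N) a x).2 = act N a x.2.
Proof. by rewrite dsE. Qed.
Definition pr2 : modhom (dsum M N) N := mkhom pr2_linear pr2_act.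
Lemma pr2E x : pr2 x = x.2. Proof. exact: mkhomE. Qed.

Lemma ex_pair X (f : modhom X M) (g : modhom X N) :
  exists h : modhom X (dsum M N), forall x, h x = (f x, g x).
Proof. by apply: hom_of_fun => [k x y|a x]; rewrite ?linearP ?dsE ?homP. Qed.

Lemma ex_copair X (f : modhom M X) (g : modhom N X) :
  exists h : modhom (dsum M N) X, forall x y, h (x, y) = f x + g y.
Proof.
have [k x y|a x|h hE] := @hom_of_fun (dsum M N) X (fun x => f x.1 + g x.2).
- by rewrite /= !linearP /= scalerDr addrACA.
- by rewrite dsE /= !homP linearD.
by exists h => x y; rewrite hE.
Qed.

End DirectSums.
End Toolkit.

(** * Short exact sequences *)

Section Exactness.
Local Open Scope ring_scope.
Variables (K : fieldType) (A : falgType K).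
Implicit Types M N X Y Z W : fdmod A.

Definition mdim M : nat := \dim (fullv : {vspace M}).
Definition is_zero M := forall x : M, x = 0.

Lemma is_zeroP M : is_zero M <-> (fullv : {vspace M}) = 0%VS.
Proof.
split=> [M0|f0 x]; last by apply/eqP; rewrite -memv0 -f0 memvf.
by apply/vspaceP=> x; rewrite memvf memv0 (M0 x) eqxx.
Qed.

Lemma mdim0 M : mdim M = 0%N <-> is_zero M.
Proof.
rewrite is_zeroP /mdim; split=> [/eqP|->]; last exact: dimv0.
by rewrite dimv_eq0 => /eqP.
Qed.

Lemma nonzeroP M : nonzero M <-> ~ is_zero M.
Proof. by rewrite is_zeroP. Qed.

Lemma not_is_zero M : ~ is_zero M -> exists x : M, x <> 0.
Proof. by move/existsNP. Qed.

Lemma mdim_ses X M Z (f : modhom X M) (g : modhom M Z) :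
  ses f g -> mdim M = (mdim X + mdim Z)%N.
Proof.
case=> /minjP f0 /kerimP fg /msurjP gs; rewrite /mdim -(limg_ker_dim g) capfv -fg gs.
by rewrite -(limg_ker_dim f) capfv (f0 : lker f = _) dimv0.
Qed.

Lemma mdim_minj M N (f : modhom M N) : minj f -> (mdim M <= mdim N)%N.
Proof.
by move=> f0; have [Z [g [gs gk]]] := ex_coker f; rewrite (@mdim_ses _ _ _ f g) ?leq_addr.
Qed.

Lemma mdim_msurj M N (f : modhom M N) : msurj f -> (mdim N <= mdim M)%N.
Proof.
by move=> f0; have [Z [g [gs gk]]] := ex_ker f; rewrite (@mdim_ses _ _ _ g f) ?leq_addl.
Qed.

Lemma minj_dim_surj M N (f : modhom M N) : minj f -> (mdim N <= mdim M)%N -> msurj f.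
Proof.
move=> f0; have [Z [g [gs gk]]] := ex_coker f.
rewrite (@mdim_ses _ _ _ f g) // -{2}[mdim M]addn0 leq_add2l leqn0 => /eqP/mdim0 Z0 y.
exact/gk/Z0.
Qed.

Lemma msurj_dim_inj M N (f : modhom M N) : msurj f -> (mdim M <= mdim N)%N -> minj f.
Proof.
move=> f0; have [Z [g [gs gk]]] := ex_ker f.
rewrite (@mdim_ses _ _ _ g f) // -{2}[mdim N]add0n leq_add2r leqn0 => /eqP/mdim0 Z0 y.
by case/gk=> x <-; rewrite (Z0 x) linear0.
Qed.

Lemma mdim_iso M N : iso M N -> mdim M = mdim N.
Proof.
case/iso_bij=> f [fi fs]; apply/eqP.
by rewrite eqn_leq (mdim_minj fi) (mdim_msurj fs).
Qed.

Lemma ses_dsum M N : ses (ds1 M N) (pr2 M N).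
Proof.
split=> [x|[x y]|y].
- by rewrite ds1E => -[].
- rewrite pr2E /=; split=> [->|[z]]; last by rewrite ds1E => -[].
  by exists x; rewrite ds1E.
by exists (0, y); rewrite pr2E.
Qed.

Lemma mdim_dsum M N : mdim (dsum M N) = (mdim M + mdim N)%N.
Proof. exact: mdim_ses (ses_dsum M N). Qed.

Lemma dsum_eta M N (x : M) (y : N) : ((x, y) : dsum M N) = ds1 M N x + ds2 M N y.
Proof. by rewrite ds1E ds2E; apply/eqP; rewrite xpair_eqE /= addr0 add0r !eqxx. Qed.

Lemma mdim_ses_lt X M Z (f : modhom X M) (g : modhom M Z) :
  ses f g -> ~ is_zero X -> (mdim Z < mdim M)%N.
Proof.
move=> fg X0; rewrite (mdim_ses fg) -{1}[mdim Z]add0n ltn_add2r lt0n.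
by apply/eqP=> /mdim0.
Qed.

Lemma zero_mod_zero : is_zero (zero_mod A).
Proof. by move=> y; apply/rowP=> -[]. Qed.

Lemma ses_id_zero M : ses (id_hom M) (hom_zero M (zero_mod A)).
Proof.
split=> [y|y|y]; first by rewrite id_homE.
  by rewrite hom_zeroE; split=> // _; exists y; rewrite id_homE.
by exists 0; rewrite hom0 (zero_mod_zero y).
Qed.

Lemma minj_comp M N X (g : modhom N X) (f : modhom M N) :
  minj g -> minj f -> minj (comp_hom g f).
Proof. by move=> gi fi x; rewrite comp_homE => /gi/fi. Qed.

Lemma msurj_comp M N X (g : modhom N X) (f : modhom M N) :
  msurj g -> msurj f -> msurj (comp_hom g f).
Proof.
by move=> gs fs z; have [y <-] := gs z; have [x <-] := fs y; exists x; rewrite comp_homE.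
Qed.

Lemma ses_coker X M (f : modhom X M) : minj f -> exists Z (g : modhom M Z), ses f g.
Proof. by move=> fi; have [Z [g [? ?]]] := ex_coker f; exists Z, g. Qed.

Lemma ses_ker M Z (g : modhom M Z) : msurj g -> exists X (f : modhom X M), ses f g.
Proof. by move=> fi; have [X [f [? ?]]] := ex_ker g; exists X, f. Qed.

Lemma ses_comp0 X M Z (f : modhom X M) (g : modhom M Z) x : kerim f g -> g (f x) = 0.
Proof. by move=> fg; apply/fg; exists x. Qed.

Lemma ex_pullback M W Z (g : modhom M Z) (h : modhom W Z) :
  exists B (b1 : modhom B M) (b2 : modhom B W),
  [/\ forall b, g (b1 b) = h (b2 b),
      forall m w, g m = h w -> exists b, b1 b = m /\ b2 b = w &
      forall b, b1 b = 0 -> b2 b = 0 -> b = 0].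
Proof.
have [d dE] := ex_copair g (hom_sub (hom_zero W Z) h).
have [B [b [bi bk]]] := ex_ker d.
exists B, (comp_hom (pr1 M W) b), (comp_hom (pr2 M W) b); split.
- move=> x; have : d (b x) = 0 by apply: ses_comp0.
  rewrite !comp_homE pr1E pr2E; case: (b x) => m w /=.
  by rewrite dE hom_subE hom_zeroE sub0r => /eqP; rewrite subr_eq0 => /eqP.
- move=> m w gh; have /bk[x xE] : d (m, w) = 0.
    by rewrite dE hom_subE hom_zeroE sub0r gh subrr.
  by exists x; rewrite !comp_homE xE pr1E pr2E.
move=> x; rewrite !comp_homE pr1E pr2E => x1 x2; apply: bi.
by case: (b x) x1 x2 => m w /= -> ->.
Qed.

(** B is the cokernel of x |-> (f x, - h x). Besides the universal property, exactness of pushed-out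
    sequences needs that [c1] and [c2] jointly cover B and meet only in elements that come from
    X. *)
Lemma ex_pushout M X Y (f : modhom X M) (h : modhom X Y) :
  exists B (c1 : modhom M B) (c2 : modhom Y B),
  [/\ forall x, c1 (f x) = c2 (h x),
      forall b, exists m y, b = c1 m + c2 y,
      forall m y, c1 m = c2 y -> exists x, f x = m /\ h x = y &
      forall V (u : modhom M V) (v : modhom Y V), (forall x, u (f x) = v (h x)) ->
        exists w : modhom B V, (forall m, w (c1 m) = u m) /\ (forall y, w (c2 y) = v y)].
Proof.
have [d dE] := ex_pair f (hom_sub (hom_zero X Y) h).
have {}dE x : d x = (f x, - h x) by rewrite dE hom_subE hom_zeroE sub0r.
have [B [c [cs ck]]] := ex_coker d.
have cE (x : M) (y : Y) : c (x, y) = c (x, 0) + c (0, y).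
  rewrite -linearD; congr (c _); apply/eqP; rewrite xpair_eqE /=.
  by rewrite addr0 add0r !eqxx.
have cN (y : Y) : c (0, - y) = - c (0, y).
  rewrite -linearN; congr (c _); apply/eqP; rewrite xpair_eqE /=.
  by rewrite oppr0 !eqxx.
exists B, (comp_hom c (ds1 M Y)), (comp_hom c (ds2 M Y)); split.
- move=> x; rewrite !comp_homE ds1E ds2E; apply/eqP.
  rewrite -subr_eq0 -cN -cE; apply/eqP/ck; exists x; exact: dE.
- move=> b; have [[x y] <-] := cs b; exists x, y.
  by rewrite cE !comp_homE ds1E ds2E.
- move=> m y; rewrite !comp_homE ds1E ds2E => /eqP; rewrite -subr_eq0 -cN -cE.
  move=> /eqP/ck[x]; rewrite dE => -[xm xy]; exists x; split=> //.
  by apply: oppr_inj.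
move=> V u v uv; have [e eE] := ex_copair u v.
have [|w wE] := @factor_surj _ _ _ _ _ c e cs.
  move=> _ /ck[x <-]; rewrite dE eE linearN uv subrr //.
by exists w; split=> x; rewrite comp_homE wE ?ds1E ?ds2E eE linear0 ?addr0 ?add0r.
Qed.

Lemma ses_retract X M Z (f : modhom X M) (g : modhom M Z) (s : modhom Z M) :
  ses f g -> (forall z, g (s z) = z) ->
  exists r : modhom M X, forall x, r (f x) = x.
Proof.
case=> fi fg gs gsK.
have [|r rE] := @factor_inj _ _ _ _ _ f (hom_sub (id_hom M) (comp_hom s g)) fi.
  move=> x; apply/fg; rewrite hom_subE comp_homE id_homE linearB /= gsK subrr //.
exists r => x; apply: (minj_inj fi).
by rewrite rE hom_subE comp_homE id_homE (ses_comp0 _ fg) linear0 subr0.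
Qed.

Lemma ses_section X M Z (f : modhom X M) (g : modhom M Z) (r : modhom M X) :
  ses f g -> (forall x, r (f x) = x) ->
  exists s : modhom Z M, (forall z, g (s z) = z) /\ (forall z, r (s z) = 0).
Proof.
case=> fi fg gs rK.
have [|s sE] := @factor_surj _ _ _ _ _ g (hom_sub (id_hom M) (comp_hom f r)) gs.
  by move=> _ /fg[x <-]; rewrite hom_subE comp_homE id_homE rK subrr.
exists s; split=> z; have [x <-] := gs z;
  rewrite sE hom_subE comp_homE id_homE linearB /= ?rK ?subrr //.
by rewrite (ses_comp0 _ fg) subr0.
Qed.

Lemma split_iso X M Z (f : modhom X M) (g : modhom M Z) (r : modhom M X) :
  ses f g -> (forall x, r (f x) = x) -> iso M (dsum X Z).
Proof.
move=> fgs rK; have [s [sK rs]] := ses_section fgs rK; case: fgs => fi fg gs.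
have [h hE] := ex_pair r g; apply: (@bij_iso _ _ _ _ h) => [x|[x z]].
  by rewrite hE => -[rx /fg[y yE]]; rewrite -yE -[y]rK yE rx linear0.
exists (f x + s z); rewrite hE !linearD /= rK rs sK (ses_comp0 _ fg).
by rewrite addr0 add0r.
Qed.

Lemma ex_complement X M (i : modhom X M) (r : modhom M X) :
  (forall x, r (i x) = x) -> exists Z (g : modhom M Z), ses i g.
Proof. by move=> rK; apply: ses_coker => x ix; rewrite -[x]rK ix linear0. Qed.

Lemma ses_iso_l X X' M Z (f : modhom X M) (g : modhom M Z) :
  ses f g -> iso X' X -> exists f' : modhom X' M, ses f' g.
Proof.
case=> fi fg gs /iso_bij[h [hi hs]]; exists (comp_hom f h); split=> //.
  exact: minj_comp.
move=> y; rewrite fg; split=> -[x <-]; last by exists (h x); rewrite comp_homE.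
by have [z <-] := hs x; exists z; rewrite comp_homE.
Qed.

Lemma ses_iso_m X M M' Z (f : modhom X M) (g : modhom M Z) :
  ses f g -> iso M M' ->
  exists (f' : modhom X M') (g' : modhom M' Z), ses f' g'.
Proof.
case=> fi fg gs /isoP[h [k [hK kK]]]; exists (comp_hom h f), (comp_hom g k); split.
- by move=> x; rewrite comp_homE => e; apply: fi; rewrite -[f x]hK e linear0.
- move=> y; rewrite comp_homE fg; split=> -[x].
    by move=> e; exists x; rewrite comp_homE e kK.
  by rewrite comp_homE => <-; exists x; rewrite hK.
by apply: msurj_comp => // x; exists (h x).
Qed.

Lemma ses_iso_r X M Z Z' (f : modhom X M) (g : modhom M Z) :
  ses f g -> iso Z Z' -> exists g' : modhom M Z', ses f g'.
Proof.
case=> fi fg gs /iso_bij[h [hi hs]]; exists (comp_hom h g); split=> //.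
  move=> y; rewrite comp_homE -fg; split=> [/hi//|->]; exact: linear0.
exact: msurj_comp.
Qed.

(** M' is the preimage of Z' in M, obtained as the kernel of M -> Z -> W. It turns a filtration step
    of the quotient Z into one of M. *)
Lemma ses_preimage X M Z Z' W (f : modhom X M) (g : modhom M Z)
    (f' : modhom Z' Z) (g' : modhom Z W) :
  ses f g -> ses f' g' ->
  exists M' (a : modhom M' M) (b : modhom X M') (c : modhom M' Z'),
    [/\ ses a (comp_hom g' g), ses b c & forall x, a (b x) = f x].
Proof.
case=> fi fg gs [fi' fg' gs'].
have [M' [a [ai ak]]] := ex_ker (comp_hom g' g).
have [x|b bE] := @factor_inj _ _ _ _ _ a f ai.
  by apply/ak; rewrite comp_homE (ses_comp0 _ fg) linear0.
have [x|c cE] := @factor_inj _ _ _ _ _ f' (comp_hom g a) fi'.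
  by apply/fg'; rewrite comp_homE -comp_homE (ses_comp0 _ ak).
exists M', a, b, c; split=> //; split=> //; first exact: msurj_comp.
- by move=> x bx; apply: fi; rewrite -bE bx linear0.
- move=> y; split=> [cy|[x <-]]; last first.
    by apply: fi'; rewrite cE comp_homE bE (ses_comp0 _ fg).
  have /fg[x xE] : g (a y) = 0 by rewrite -comp_homE -cE cy linear0.
  by exists x; apply: (minj_inj ai); rewrite bE.
move=> z; have [m mE] := gs (f' z).
have /ak[y yE] : comp_hom g' g m = 0 by rewrite comp_homE mE (ses_comp0 _ fg').
by exists y; apply: (minj_inj fi'); rewrite cE comp_homE yE.
Qed.

(** The third isomorphism theorem: with R = X / Y and Q = M / Y, the sequence R -> Q -> Z is
    exact. *)
Lemma ses_coker_comp X Y M Z Q R (f : modhom X M) (g : modhom M Z) (i : modhom Y X)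
    (q : modhom M Q) (r : modhom X R) :
  ses f g -> kerim (comp_hom f i) q -> msurj q -> kerim i r -> msurj r ->
  exists (b : modhom R Q) (c : modhom Q Z), ses b c.
Proof.
case=> fi fg gs qk qs rk rs.
have [x|b bE] := @factor_surj _ _ _ _ _ r (comp_hom q f) rs.
  by case/rk=> y <-; rewrite comp_homE -(comp_homE f) (ses_comp0 _ qk).
have [x|c cE] := @factor_surj _ _ _ _ _ q g qs.
  by case/qk=> y <-; rewrite comp_homE (ses_comp0 _ fg).
exists b, c; split.
- move=> z; have [x <-] := rs z; rewrite bE comp_homE => /qk[y].
  by rewrite comp_homE => /(minj_inj fi) <-; rewrite (ses_comp0 _ rk).
- move=> z; have [m <-] := qs z; rewrite cE fg; split=> -[x].
    by move=> <-; exists (r x); rewrite bE comp_homE.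
  have [y <-] := rs x; rewrite bE comp_homE => e.
  have /qk[w] : q (m - f y) = 0 by rewrite linearB /= e subrr.
  rewrite comp_homE => wE; exists (i w + y).
  by rewrite linearD /= wE subrK.
by move=> z; have [m <-] := gs z; exists (q m); rewrite cE.
Qed.

Lemma is_zero_iso M N : is_zero M -> is_zero N -> iso M N.
Proof.
move=> M0 N0; apply: (@bij_iso _ _ _ _ (hom_zero M N)) => [x _|y]; first exact: M0.
by exists 0; rewrite hom_zeroE (N0 y).
Qed.

Lemma ses_zero_l X M Z (f : modhom X M) (g : modhom M Z) :
  ses f g -> is_zero X -> iso M Z.
Proof.
case=> fi fg gs X0; apply: (@bij_iso _ _ _ _ g) => // x /fg[y <-].
by rewrite (X0 y) linear0.
Qed.

Lemma ses_zero_r X M Z (f : modhom X M) (g : modhom M Z) :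
  ses f g -> is_zero Z -> iso X M.
Proof. by case=> fi fg gs X0; apply: (@bij_iso _ _ _ _ f) => // x; apply/fg/X0. Qed.

End Exactness.

(** * Duality *)

Section Duality.
Local Open Scope ring_scope.
Variables (K : fieldType) (A : falgType K) (D : cofunctor A).
Hypothesis hD : simple_preserving_duality D.
Implicit Types M N X Y Z W : fdmod A.

Lemma dual_ses X M Z (f : modhom X M) (g : modhom M Z) :
  ses f g -> ses (cmap D g) (cmap D f).
Proof. by case: hD => De _ _ _ /sesP/De/sesP. Qed.

Lemma dual_inj M N (f : modhom M N) : minj f -> msurj (cmap D f).
Proof. by case/ses_coker=> Z [g /dual_ses[]]. Qed.

Lemma dual_surj M N (f : modhom M N) : msurj f -> minj (cmap D f).
Proof. by case/ses_ker=> Z [g /dual_ses[]]. Qed.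

Lemma dual_comp M N X (g : modhom N X) (f : modhom M N) (h : modhom M X) :
  (forall x, g (f x) = h x) -> forall y, cmap D f (cmap D g y) = cmap D h y.
Proof.
move=> gf y; have <- : comp_hom g f = h by apply: hom_ext => x; rewrite comp_homE.
by rewrite cmap_comp comp_homE.
Qed.

Lemma dual_id M (f : modhom M M) : (forall x, f x = x) -> forall y, cmap D f y = y.
Proof.
move=> fE y; have -> : f = id_hom M by apply: hom_ext => x; rewrite fE id_homE.
by rewrite cmap_id id_homE.
Qed.

Lemma dual_faithful M N (f g : modhom M N) :
  (forall y, cmap D f y = cmap D g y) -> forall x, f x = g x.
Proof. by case: hD => _ [Df _ _] _ _ /hom_ext/Df->. Qed.

Lemma dual_full M N (h : modhom (D N) (D M)) : exists f : modhom M N, cmap D f = h.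
Proof. by case: hD => _ [_ Df _] _ _; apply: Df. Qed.

(** For zero M the identities M -> M -> M form a short exact sequence. In its dual the two
    identities of D M compose to zero, so D M is zero. *)
Lemma dual_is_zero M : is_zero M -> is_zero (D M).
Proof.
move=> M0; have : ses (id_hom M) (id_hom M).
  by split=> [x|x|x]; rewrite ?(M0 x) //; [split=> _; [exists 0|]; rewrite linear0|exists 0; rewrite linear0].
case/dual_ses=> _ k _ x; have : cmap D (id_hom M) (cmap D (id_hom M) x) = 0.
  exact: ses_comp0.
by rewrite !dual_id // => y; rewrite id_homE.
Qed.

(** A [cofunctor] comes with no additivity, so the argument is that a zero map factors through the
    zero module, whose dual is zero. *)
Lemma dual_zero M N (f : modhom M N) : (forall x, f x = 0) -> forall y, cmap D f y = 0.
Proof.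
move=> f0 y; rewrite -(@dual_comp _ _ _ (hom_zero (zero_mod A) N) (hom_zero M (zero_mod A))).
  have -> : cmap D (hom_zero (zero_mod A) N) y = 0; last exact: linear0.
  exact/dual_is_zero/zero_mod_zero.
by move=> x; rewrite hom_zeroE f0.
Qed.

Lemma dual_iso M N : iso M N -> iso (D M) (D N).
Proof.
case/isoP=> f [g [fK gK]]; apply/isoP; exists (cmap D g), (cmap D f); split=> x.
  by rewrite (@dual_comp _ _ _ _ _ (id_hom M)) ?dual_id // => y; rewrite id_homE ?fK.
by rewrite (@dual_comp _ _ _ _ _ (id_hom N)) ?dual_id // => y; rewrite id_homE ?gK.
Qed.

Lemma bidual_iso M : iso M (D (D M)).
Proof. by case: hD => _ _ [eta [eiso _]] _; exists (eta M). Qed.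

Lemma dual_simple S : simple S -> iso (D S) S.
Proof. by case: hD => _ _ _; apply. Qed.

Lemma dual_is_zeroV M : is_zero (D M) -> is_zero M.
Proof.
move=> /dual_is_zero DD0; have /iso_bij[f [fi _]] := bidual_iso M.
by move=> x; apply/fi/DD0.
Qed.

Lemma ex_bidual : exists eta : forall M, modhom M (D (D M)),
  (forall M, minj (eta M) /\ msurj (eta M)) /\
  (forall M N (f : modhom M N) x, eta N (f x) = cmap D (cmap D f) (eta M x)).
Proof.
case: hD => _ _ [eta [eiso enat]] _; exists eta; split=> [M|M N f x].
  by case: (eiso M) => /minjP ? /msurjP.
by rewrite -!comp_homE enat.
Qed.

End Duality.

(** * Filtrations *)

Section Filtrations.
Local Open Scope ring_scope.
Variables (K : fieldType) (A : falgType K) (I : Type) (S : I -> fdmod A).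
Implicit Types M N X Y Z W : fdmod A.

Inductive filt (J : pred I) : fdmod A -> Prop :=
| filt_zero M : is_zero M -> filt J M
| filt_step X M i (f : modhom X M) (g : modhom M (S i)) :
    J i -> filt J X -> ses f g -> filt J M.

Lemma filt_iso J M N : iso M N -> filt J M -> filt J N.
Proof.
move=> MN FM; case: FM MN => [{}M M0|X {}M i f g Ji FX fg] MN.
  by apply: filt_zero; apply/mdim0; rewrite -(mdim_iso MN); apply/mdim0.
by have [f' [g' fg']] := ses_iso_m fg MN; apply: filt_step fg'.
Qed.

Lemma filt_ext J X M Z (f : modhom X M) (g : modhom M Z) :
  ses f g -> filt J X -> filt J Z -> filt J M.
Proof.
move=> fg FX FZ; elim: FZ X M f g fg FX => {Z} [Z Z0|Z' Z i f' g' Ji _ IH fg'] X M f g fg FX.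
  exact: filt_iso (ses_zero_r fg Z0) FX.
have [M' [a [b [c [ses1 ses2 _]]]]] := ses_preimage fg fg'.
exact: (filt_step Ji (IH _ _ _ _ ses2 FX) ses1).
Qed.

Lemma filt_sub (J J' : pred I) M : (forall i, J i -> J' i) -> filt J M -> filt J' M.
Proof.
move=> JJ'; elim=> {M} [M M0|X M i f g Ji _ IH fg]; first exact: filt_zero.
exact: filt_step (JJ' _ Ji) IH fg.
Qed.

Lemma filt_one (J : pred I) i : J i -> filt J (S i).
Proof.
move=> Ji; apply: (@filt_step _ _ _ i (hom_zero _ _) (id_hom _) Ji (filt_zero J (@zero_mod_zero _ A))).
split=> [x _|x|x]; [exact: zero_mod_zero| |by exists x; rewrite id_homE].
rewrite id_homE; split=> [->|[y <-]]; last exact: hom_zeroE.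
by exists 0; rewrite hom_zeroE.
Qed.

Lemma filtered_by_filt J M (V : submod M) N (i : modhom N M) :
  minj i -> (forall x, x \in submod_space V <-> exists y, i y = x) ->
  filtered_by S J V -> filt J N.
Proof.
move=> ii iV [n [F [[F0 Fn Fs] FS]]].
suff {ii iV} H k : (k <= n)%N -> forall N (i : modhom N M), minj i ->
    (forall x, x \in submod_space (F k) <-> exists y, i y = x) -> filt J N.
  by apply: (H n _ _ i) => // x; rewrite Fn.
elim: k => [|k IH] kn {}N {}i ii iF.
  apply: filt_zero => y; apply: ii; apply/eqP; rewrite -memv0 -F0.
  by apply/iF; exists y.
have [j Jj /iso_bij[h [hi hs]]] := FS _ kn.
have [s [ss sk]] := @subquotP _ _ _ _ (F k) _ _ iF.
have [X [f [fi fk]]] := ex_ker s.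
apply: (@filt_step _ X _ j f (comp_hom h s) Jj).
  apply: (IH (ltnW kn) X (comp_hom i f)); first exact: minj_comp.
  move=> x; split=> [xF|[y <-]]; last first.
    by rewrite comp_homE -sk; apply/fk; exists y.
  have /iF[y yx] : x \in submod_space (F k.+1) by apply: (subvP (Fs _ kn)).
  have /fk[z zy] : s y = 0 by apply/sk; rewrite yx.
  by exists z; rewrite comp_homE zy.
split=> //; last exact: msurj_comp.
move=> y; rewrite comp_homE -fk; split=> [/hi//|->]; exact: linear0.
Qed.

Lemma filt_filtered_by J M (V : submod M) N (i : modhom N M) :
  minj i -> (forall x, x \in submod_space V <-> exists y, i y = x) ->
  filt J N -> filtered_by S J V.
Proof.
move=> ii iV FN; elim: FN M V i ii iV => {N} [N N0|X N j f g Jj _ IH [fi fg gs]] M V i ii iV.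
  exists 0%N, (fun _ => V); split=> //; split=> //.
  apply/vspaceP=> x; rewrite memv0; apply/idP/eqP=> [/iV[y <-]|->].
    by rewrite (N0 y) linear0.
  exact: mem0v.
have fii : minj (comp_hom i f) by apply: minj_comp.
have [n [F [[F0 Fn Fs] FS]]] := IH _ (himg (comp_hom i f)) _ fii (@himgP _ _ _ _ _).
have FnP x : x \in submod_space (F n) <-> exists y, i (f y) = x.
  by rewrite Fn; rewrite himgP; split=> -[y <-]; exists y; rewrite comp_homE.
(* The filtration of the image of X, with V put on top as step n.+1. *)
exists n.+1, (fun k => if (k <= n)%N then F k else V).
split; first split=> //=; first by rewrite ltnn.
  move=> k; rewrite ltnS => kn; rewrite kn; case: ltnP => [/Fs//|nk].
  have <- : n = k by apply/eqP; rewrite eqn_leq nk.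
  by apply/subvP=> x /FnP[y <-]; apply/iV; exists (f y).
move=> k kS; have /orP[/eqP->|kn] : (k == n) || (k < n)%N by rewrite -leq_eqVlt.
  2: by rewrite (ltnW kn) kn; apply: FS.
rewrite ltnn leqnn; exists j => //.
have [s [ss sk]] := @subquotP _ _ _ _ (F n) _ _ iV.
have gsk y : g y = 0 <-> s y = 0.
  rewrite sk fg FnP; split=> -[x]; last by move/(minj_inj ii) <-; exists x.
  by move=> <-; exists x.
have [y|h hE] := @factor_surj _ _ _ _ _ s g ss; first by move/gsk.
apply: (@bij_iso _ _ _ _ h) => y.
  by have [x <-] := ss y; rewrite hE => /gsk.
by have [x <-] := gs y; exists (s x); rewrite hE.
Qed.

Lemma filt_fullP J M : filt J M <-> filtered_by S J (full_submod M).
Proof.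
have iM : minj (id_hom M) by move=> x; rewrite id_homE.
have fM x : x \in submod_space (full_submod M) <-> exists y, id_hom M y = x.
  by rewrite memvf; split=> // _; exists x; rewrite id_homE.
by split; [apply: filt_filtered_by iM fM | apply: filtered_by_filt iM fM].
Qed.

End Filtrations.

(** * Simple modules *)

Section Simples.
Local Open Scope ring_scope.
Variables (K : fieldType) (A : falgType K).
Implicit Types M N X Y Z W S : fdmod A.

Lemma simple_inj S M (f : modhom S M) x : simple S -> f x <> 0 -> minj f.
Proof.
move=> [_ /(_ (hker f))[k0|kf]] fx; first exact/minjP.
by case: fx; apply/hkerP; rewrite kf memvf.
Qed.

Lemma simple_surj S M (f : modhom M S) x : simple S -> f x <> 0 -> msurj f.
Proof.
move=> [_ /(_ (himg f))[k0|kf]] fx; last by apply/msurjP.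
by case: fx; apply/eqP; rewrite -memv0 -k0; apply/himgP; exists x.
Qed.

Lemma simple_nz S : simple S -> exists x : S, x <> 0.
Proof. by case=> /nonzeroP /not_is_zero. Qed.

Lemma simple_iso S M : simple S -> iso S M -> simple M.
Proof.
move=> [/nonzeroP S0 Ss] SM; split.
  by apply/nonzeroP=> /mdim0; rewrite -(mdim_iso SM) => /mdim0.
move=> U; have [i [ii iU]] := submod_modP U; have [h [k [hK kK]]] := (isoP _ _).1 SM.
have UE x : x \in submod_space U <-> h (k x) \in submod_space U by rewrite kK.
have [e|e] := Ss (himg (comp_hom k i)); [left|right]; apply/vspaceP=> x.
  rewrite memv0; apply/idP/eqP=> [/iU[y <-]|->]; last exact: mem0v.
  have : k (i y) \in submod_space (himg (comp_hom k i)).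
    by apply/himgP; exists y; rewrite comp_homE.
  by rewrite e memv0 => /eqP e0; rewrite -[i y]kK e0 linear0.
rewrite memvf; have : k x \in submod_space (himg (comp_hom k i)) by rewrite e memvf.
by case/himgP=> y; rewrite comp_homE => e1; apply/iU; exists y; rewrite -[i y]kK e1 kK.
Qed.

Lemma ex_simple_sub M : ~ is_zero M ->
  exists S (i : modhom S M), simple S /\ minj i.
Proof.
have [n] := ubnP (mdim M); elim: n M => // n IH M Mn M0.
have [sM|nsM] := pselect (simple M).
  by exists M, (id_hom M); split=> // x; rewrite id_homE.
have [U [U0 U1]] : exists U : submod M,
    submod_space U <> 0%VS /\ submod_space U <> fullv.
  have /existsNP[U /not_orP[? ?]] : ~ forall U : submod M,
    submod_space U = 0%VS \/ submod_space U = fullv.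
    by move=> H; apply: nsM; split=> //; apply/nonzeroP.
  by exists U.
have [i [ii iU]] := submod_modP U.
have nz : ~ is_zero (submod_mod U).
  move=> z; apply: U0; apply/vspaceP=> x; rewrite memv0.
  by apply/idP/eqP=> [/iU[y <-]|->]; rewrite ?mem0v // (z y) linear0.
have [|S [j [sS ji]]] := IH _ _ nz; last first.
  by exists S, (comp_hom i j); split=> //; apply: minj_comp.
rewrite -ltnS; apply: leq_trans Mn; rewrite ltnS ltn_neqAle (mdim_minj ii) andbT.
apply/eqP=> e; apply: U1; apply/vspaceP=> x; rewrite memvf; apply/iU.
by apply: minj_dim_surj ii _ _; rewrite e.
Qed.

End Simples.

(** * Composition factors and standard modules *)

Section Weights.
Local Open Scope ring_scope.
Variables (K : fieldType) (A : falgType K) (Lam : Type) (L : Lam -> fdmod A).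
Hypothesis hL : simples_representatives L.
Variables (P : Lam -> fdmod A) (p : forall l, modhom (P l) (L l)).
Hypothesis hP : forall l, projective_cover (p l).
Implicit Types M N X Y Z W : fdmod A.

Lemma proj_lift Q X Y (g : modhom X Y) (h : modhom Q Y) : projective Q -> msurj g ->
  exists h' : modhom Q X, forall x, g (h' x) = h x.
Proof.
by move=> pQ /msurjP gs; have [h' <-] := pQ _ _ g h gs; exists h' => x; rewrite comp_homE.
Qed.

Lemma cover_proj l : projective (P l). Proof. by case: (hP l). Qed.
Lemma cover_surj l : msurj (p l). Proof. by case: (hP l) => _ /msurjP. Qed.

Lemma simpleL l : simple (L l). Proof. by case: hL. Qed.

Lemma cover_small l U (i : modhom U (P l)) : msurj (comp_hom (p l) i) -> msurj i.
Proof.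
move=> s; have [_ _ small] := hP l; have := small (himg i) _; rewrite /=.
move=> e; apply/msurjP/e; apply/vspaceP=> x; rewrite memvf.
have [y yE] := s (p l x); rewrite -[x](subrK (i y)) addrC memv_add //.
  by rewrite memv_img ?memvf.
by rewrite memv_ker linearB /= -yE comp_homE subrr.
Qed.

(* [L l] is a composition factor of [M], tested on its projective cover. *)
Definition wt l M := exists f : modhom (P l) M, exists x, f x <> 0.

Lemma wt_nz l M : wt l M -> ~ is_zero M.
Proof. by case=> f [x fx] M0; apply/fx/M0. Qed.

Lemma wt_sub l M N (i : modhom M N) : minj i -> wt l M -> wt l N.
Proof. by move=> ii [f [x fx]]; exists (comp_hom i f), x; rewrite comp_homE => /ii. Qed.

Lemma wt_quot l M N (g : modhom M N) : msurj g -> wt l N -> wt l M.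
Proof.
move=> gs [f [x fx]]; have [f' fE] := proj_lift f (@cover_proj l) gs.
by exists f', x => e; apply: fx; rewrite -fE e linear0.
Qed.

Lemma wt_iso l M N : iso M N -> wt l M -> wt l N.
Proof. by case/iso_bij=> f [fi _]; apply: wt_sub fi. Qed.

Lemma wt_ses l X M Z (f : modhom X M) (g : modhom M Z) : ses f g ->
  wt l M -> wt l X \/ wt l Z.
Proof.
case=> fi fg gs [h [x hx]]; have [gh|] := pselect (forall y, g (h y) = 0); last first.
  by case/existsNP=> y ghy; right; exists (comp_hom g h), y; rewrite comp_homE.
have [y|h' hE] := factor_inj (h := h) fi; first exact/fg/gh.
by left; exists h', x => e; apply: hx; rewrite -hE e linear0.
Qed.

(** A nonzero quotient of P l still has L l as a quotient. Otherwise the kernel of s would map onto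
    L l, hence be all of P l by smallness, and s would vanish. *)
Lemma cover_quot l Y (s : modhom (P l) Y) x : msurj s -> s x <> 0 ->
  exists t : modhom Y (L l), forall y, t (s y) = p l y.
Proof.
move=> ss sx; apply: factor_surj ss _ => y sy.
have [U [k [ki kk]]] := ex_ker s.
apply: contrapT => py; have /kk[u uE] := sy.
have /(simple_surj (simpleL l))/cover_small ks : comp_hom (p l) k u <> 0.
  by rewrite comp_homE uE.
by apply: sx; apply/kk; apply: ks.
Qed.

Lemma cover_nz l : exists x, p l x <> 0.
Proof.
by have [y y0] := simple_nz (simpleL l); have [x xE] := cover_surj y; exists x; rewrite xE.
Qed.

Lemma wtL l : wt l (L l).
Proof. by have [x x0] := cover_nz l; exists (p l), x. Qed.

Lemma wtL_eq l m : wt l (L m) -> l = m.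
Proof.
case=> f [x fx]; have fs := simple_surj (simpleL m) fx.
have [t tE] := cover_quot fs fx; have [y y0] := cover_nz l.
have ty : t (f y) <> 0 by rewrite tE.
have ti := simple_inj (simpleL m) ty; have ts := simple_surj (simpleL l) ty.
by case: hL => _ _ inj; apply: inj; apply/iso_sym/(bij_iso ti ts).
Qed.

Lemma ex_L_sub M : ~ is_zero M -> exists l (i : modhom (L l) M), minj i.
Proof.
case/ex_simple_sub=> S [i [sS ii]]; have [_ rep _] := hL.
have [l /iso_sym/iso_bij[f [fi _]]] := rep _ sS.
by exists l, (comp_hom i f); apply: minj_comp.
Qed.

Lemma ex_wt M : ~ is_zero M -> exists l, wt l M.
Proof. by case/ex_L_sub=> l [i ii]; exists l; apply: wt_sub ii (wtL l). Qed.

Lemma filtL_wt (J : pred Lam) M m : filt L J M -> wt m M -> J m.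
Proof.
move=> FM; elim: FM => {M} [M M0 wM|X M i f g Ji _ IH fg]; first by case: (wt_nz wM M0).
by case/(wt_ses fg)=> // /(wtL_eq) ->.
Qed.

Section DualWeights.
Variables (D : cofunctor A) (hD : simple_preserving_duality D).

(** The image Y of a nonzero map P l -> M maps onto L l. Dually L l, being isomorphic to its dual,
    embeds in D Y, which is a quotient of D M. *)
Lemma wt_dual l M : wt l M -> wt l (D M).
Proof.
case=> f [x fx]; have [Y [s [i [ss ii si]]]] := ex_img f.
have sx : s x <> 0 by move=> e; apply: fx; rewrite -si e linear0.
have [t tE] := cover_quot ss sx; have [y y0] := cover_nz l.
have ts : msurj t by apply: (@simple_surj _ _ _ _ _ (s y)) (simpleL l) _; rewrite tE.
apply: (wt_quot (dual_inj hD ii)); apply: (wt_sub (dual_surj hD ts)).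
by apply: wt_iso (wtL l); apply/iso_sym/(dual_simple hD)/simpleL.
Qed.

Lemma wt_dualV l M : wt l (D M) -> wt l M.
Proof. by move/wt_dual/(wt_iso (iso_sym (bidual_iso hD M))). Qed.

End DualWeights.

End Weights.

Section Standard.
Local Open Scope ring_scope.
Variables (K : fieldType) (A : falgType K).
Variables (d : Order.disp_t) (Lam : finPOrderType d).
Variable L : Lam -> fdmod A.
Hypothesis hL : simples_representatives L.
Variables (P : Lam -> fdmod A) (p : forall l, modhom (P l) (L l)).
Hypothesis hP : forall l, projective_cover (p l).
Hypothesis hqh : quasi_hereditary p.
Implicit Types M N X Y Z W : fdmod A.

Local Notation Delta := (std P).
Local Notation wt := (wt P).
(* The category F(Delta). *)
Definition FD M := filt Delta xpredT M.

Definition stdpi l : modhom (P l) (Delta l) := quot_proj (std_kernel P l).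
Lemma stdpi_surj l : msurj (stdpi l). Proof. by case: (quot_projP (std_kernel P l)). Qed.

Definition stdker l : fdmod A := submod_mod (std_kernel P l).
Definition stdinc l : modhom (stdker l) (P l) :=
  sval (cid (submod_modP (std_kernel P l))).

Lemma stdincP l x : x \in submod_space (std_kernel P l) <-> exists y, stdinc l y = x.
Proof. by rewrite /stdinc; case: cid => i [ii iE] /=; apply: iE. Qed.

Lemma std_ses l : ses (stdinc l) (stdpi l).
Proof.
split; last exact: stdpi_surj.
  by rewrite /stdinc; case: cid => i [].
by move=> y; have [_ ->] := quot_projP (std_kernel P l); apply: stdincP.
Qed.

Lemma bigdsum_zero (s : seq Lam) (Q : pred Lam) Y :
  (forall m, Q m -> ~ wt m Y) ->
  forall (h : modhom (\big[@dsum K A/@zero_mod K A]_(m <- s | Q m) P m) Y) x, h x = 0.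
Proof.
move=> Q0; elim: s => [|m s IH]; first by rewrite big_nil => h x; rewrite (zero_mod_zero x) hom0.
rewrite big_cons; case: ifP => // Qm h [x y].
rewrite dsum_eta homD -!comp_homE IH addr0.
by apply: contrapT => hx; apply: (Q0 m Qm); exists (comp_hom h (ds1 _ _)), x.
Qed.

(** The kernel of P l -> Delta l is a trace: it is generated by images of the P m with l < m. None
    of these P m has a nonzero map to Y, so the kernel of g contains all the generating images. *)
Lemma stdker_hom0 l Y (g : modhom (stdker l) Y) :
  (forall m, (l < m)%O -> ~ wt m Y) -> forall x, g x = 0.
Proof.
move=> Y0 x; have [ki kk _] := std_ses l.
have [U [u [ui uk]]] := ex_ker g.
have [ub least] := sumv_familyP (fun W : {vspace (P l)} => exists h : modhom
   (\big[@dsum K A/@zero_mod K A]_(m | (l < m)%O) P m) (P l), W = limg h).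
have /subvP sub : (submod_space (std_kernel P l) <= limg (comp_hom (stdinc l) u))%VS.
  apply: least => _ [h ->]; apply/subvP=> y /memv_imgP[z _ ->].
  have [w|h' hE] := factor_inj (h := h) ki.
    apply/stdincP; apply: (subvP (ub (limg h) _)); first by exists h.
    by rewrite memv_img ?memvf.
  have /uk[v vE] : g (h' z) = 0 by rewrite -comp_homE; apply: bigdsum_zero z; apply: Y0.
  by apply/memv_imgP; exists v; rewrite ?memvf // comp_homE vE hE.
have xk : stdinc l x \in submod_space (std_kernel P l) by apply/stdincP; exists x.
have /memv_imgP[y _ yE] := sub _ xk.
by move: yE; rewrite comp_homE => /(minj_inj ki) ->; apply/uk; exists y.
Qed.

Lemma FD_stdker l : FD (stdker l).
Proof.
have [fb _] := hqh l; have [ki kk _] := std_ses l.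
apply: (@filt_sub _ _ _ _ (fun m => l < m)%O) => //.
apply: filtered_by_filt ki _ fb => x.
by rewrite hkerP; apply: kk.
Qed.

Lemma FD_std l : FD (Delta l). Proof. exact: filt_one. Qed.

Lemma FD_P l : FD (P l).
Proof. exact: filt_ext (std_ses l) (FD_stdker l) (FD_std l). Qed.

Lemma stdtop l : exists q : modhom (Delta l) (L l),
  (forall x, q (stdpi l x) = p l x) /\
  forall R (i : modhom R (Delta l)) m, minj i -> kerim i q -> wt m R -> (m < l)%O.
Proof.
have [_ [q qE fq]] := hqh l; exists q; split=> [x|R i m ii iq].
  by rewrite -comp_homE; congr (hom_fun _ x).
apply: (filtL_wt hL hP (J := fun m => m < l)%O); apply: filtered_by_filt ii _ fq => x.
by rewrite hkerP; apply: iq.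
Qed.

Definition stdq l := sval (cid (stdtop l)).
Lemma stdqE l x : stdq l (stdpi l x) = p l x.
Proof. exact: (svalP (cid (stdtop l))).1. Qed.
Lemma stdq_ker l R (i : modhom R (Delta l)) m :
  minj i -> kerim i (stdq l) -> wt m R -> (m < l)%O.
Proof. exact: (svalP (cid (stdtop l))).2. Qed.
Lemma stdq_surj l : msurj (stdq l).
Proof. by move=> y; have [x <-] := cover_surj hP y; exists (stdpi l x); rewrite stdqE. Qed.

Lemma wt_std l m : wt m (Delta l) -> (m <= l)%O.
Proof.
have [R [i iq]] := ses_ker (@stdq_surj l); case/(wt_ses iq).
  by case: iq => ii ik _ /(stdq_ker ii ik)/ltW.
by move/(wtL_eq hL hP)->.
Qed.

Lemma wt_std_self l : wt l (Delta l).
Proof. exact: (wt_quot hP (@stdq_surj l) (wtL hL hP l)). Qed.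

(** Inherited from P l: the pullback of U along P l -> Delta l maps onto L l, hence onto P l. *)
Lemma std_small l U (i : modhom U (Delta l)) : msurj (comp_hom (stdq l) i) -> msurj i.
Proof.
move=> s; have [B [b1 [b2 [bE bs _]]]] := ex_pullback i (stdpi l).
have /(cover_small hP) b2s : msurj (comp_hom (p l) b2).
  move=> z; have [u uE] := s z; have [x xE] := stdpi_surj (i u).
  have [b [b1E b2E]] := bs u x (esym xE).
  by exists b; rewrite comp_homE -stdqE -bE -uE comp_homE b1E.
move=> y; have [x <-] := stdpi_surj y; have [b <-] := b2s x.
by exists (b1 b); rewrite bE.
Qed.

Lemma std_hom_wt l Y (f : modhom (Delta l) Y) x : f x <> 0 -> wt l Y.
Proof.
by move=> fx; have [y yE] := stdpi_surj x; exists (comp_hom f (stdpi l)), y; rewrite comp_homE yE.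
Qed.

(** If f followed by Delta l -> L l vanishes, f lands in the kernel of this map, whose weights are
    all below l; but a nonzero map from Delta l forces the weight l on its target. *)
Lemma std_endo l (f : modhom (Delta l) (Delta l)) x : f x <> 0 -> minj f /\ msurj f.
Proof.
move=> fx; have fs : msurj f; last by split=> //; apply: msurj_dim_inj.
apply: std_small; have [z|] := pselect (forall z, stdq l (f z) = 0); last first.
  case/existsNP=> z fz; apply: (@simple_surj _ _ _ _ _ z) (simpleL hL l) _.
  by rewrite comp_homE.
have [R [i iq]] := ses_ker (@stdq_surj l); case: (iq) => ii ik _.
have [y|f' fE] := factor_inj (h := f) ii; first exact/ik.
suff /(stdq_ker ii ik) : wt l R by rewrite ltxx.
by apply: (@std_hom_wt _ _ f' x) => e; apply: fx; rewrite -fE e linear0.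
Qed.

(** A map P l -> M kills the kernel of P l -> Delta l by [stdker_hom0], because M has no weight
    above l. *)
Lemma wt_std_hom l M : wt l M -> (forall m, (l < m)%O -> ~ wt m M) ->
  exists (f : modhom (Delta l) M) x, f x <> 0.
Proof.
case=> h [x hx] M0; have [ki kk ks] := std_ses l.
have [y|f fE] := factor_surj (h := h) ks; last by exists f, (stdpi l x); rewrite fE.
by case/kk=> z <-; rewrite -comp_homE; apply: stdker_hom0.
Qed.

End Standard.

(** * Vanishing of extensions *)

Section Extensions.
Local Open Scope ring_scope.
Variables (K : fieldType) (A : falgType K).
Implicit Types M N X Y Z W V : fdmod A.

Lemma ses_pullback M M' W Z (a : modhom M M') (b : modhom M' W) (h : modhom Z W) :
  ses a b -> exists B (j : modhom M B) (b1 : modhom B M') (b2 : modhom B Z),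
  [/\ ses j b2, forall x, b1 (j x) = a x, forall x, b (b1 x) = h (b2 x),
      forall m z, b m = h z -> exists x, b1 x = m /\ b2 x = z &
      forall x, b1 x = 0 -> b2 x = 0 -> x = 0].
Proof.
case=> ai ab bs; have [B [b1 [b2 [bE B1 B2]]]] := ex_pullback b h.
have b2s : msurj b2.
  by move=> z; have [m mE] := bs (h z); have [x [_ <-]] := B1 _ _ mE; exists x.
have [X [u [ui uk]]] := ex_ker b2.
have [x|t tE] := factor_inj (h := comp_hom b1 u) ai.
  by apply/ab; rewrite comp_homE bE (ses_comp0 _ uk) hom0.
have ti : minj t.
  move=> x tx; apply/ui/B2; first by rewrite -comp_homE -tE tx hom0.
  exact: ses_comp0.
have ts : msurj t.
  move=> m; have [|x [x1 /uk[z zE]]] := B1 (a m) 0; first by rewrite hom0; apply/ab; exists m.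
  by exists z; apply: (minj_inj ai); rewrite tE comp_homE zE.
have [x|j jE] := factor_surj (h := u) ts; first by move/ti->; rewrite hom0.
exists B, j, b1, b2; split=> //; last by move=> m; have [x <-] := ts m; rewrite jE tE comp_homE.
split=> // [m|y].
  by have [x <-] := ts m; rewrite jE => /ui->; rewrite hom0.
rewrite uk; split=> -[x <-]; first by exists (t x); rewrite jE.
by have [z <-] := ts x; exists z; rewrite jE.
Qed.

Lemma ses_pushout X M Z Y (a : modhom X M) (b : modhom M Z) (h : modhom X Y) :
  ses a b -> exists B (c1 : modhom M B) (c2 : modhom Y B) (w : modhom B Z),
  [/\ ses c2 w, forall x, c1 (a x) = c2 (h x) &
      forall V (u : modhom M V) (v : modhom Y V), (forall x, u (a x) = v (h x)) ->
        exists w : modhom B V, (forall m, w (c1 m) = u m) /\ (forall y, w (c2 y) = v y)].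
Proof.
case=> ai ab bs; have [B [c1 [c2 [cE B1 B2 B3]]]] := ex_pushout a h.
have [x|w [w1 w2]] := B3 _ b (hom_zero Y Z); first by rewrite hom_zeroE (ses_comp0 _ ab).
exists B, c1, c2, w; split=> //; split.
- move=> y cy; have [|x [/ai x0 <-]] := B2 0 y; first by rewrite cy hom0.
  by rewrite x0 hom0.
- move=> z; split=> [|[y <-]]; last by rewrite w2 hom_zeroE.
  have [m [y ->]] := B1 z; rewrite homD w1 w2 hom_zeroE addr0 => /ab[x <-].
  by exists (h x + y); rewrite homD cE.
by move=> z; have [m <-] := bs z; exists (c1 m); rewrite w1.
Qed.

(* Ext^1(Z, Y) = 0, as an extension property. *)
Definition XV Z Y := forall M M' (a : modhom M M') (b : modhom M' Z), ses a b ->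
  forall h : modhom M Y, exists h' : modhom M' Y, forall x, h' (a x) = h x.

(** Pushing the given sequence out along h yields an extension of Z by Y; a retraction of it onto Y
    restricts to the required extension of h. *)
Lemma XV_of_split Z Y :
  (forall W (a : modhom Y W) (b : modhom W Z), ses a b ->
    exists r : modhom W Y, forall y, r (a y) = y) -> XV Z Y.
Proof.
move=> H M M' a b ab h; have [B [c1 [c2 [w [cw cE _]]]]] := ses_pushout h ab.
have [r rK] := H _ _ _ cw; exists (comp_hom r c1) => x.
by rewrite comp_homE cE rK.
Qed.

Lemma XV_split Z Y W (a : modhom Y W) (b : modhom W Z) : XV Z Y -> ses a b ->
  exists r : modhom W Y, forall y, r (a y) = y.
Proof. by move=> zy /zy/(_ (id_hom Y))[r rE]; exists r => y; rewrite rE id_homE. Qed.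

Lemma XV_iso Z Z' Y Y' : iso Z Z' -> iso Y Y' -> XV Z Y -> XV Z' Y'.
Proof.
move=> zz /isoP[f [g [fK gK]]] zy M M' a b ab h.
have [b' ab'] := ses_iso_r ab (iso_sym zz).
have [h' h'E] := zy _ _ _ _ ab' (comp_hom g h).
by exists (comp_hom f h') => x; rewrite comp_homE h'E comp_homE gK.
Qed.

Lemma XV_ext Z1 Z Z2 Y (f : modhom Z1 Z) (g : modhom Z Z2) :
  ses f g -> XV Z1 Y -> XV Z2 Y -> XV Z Y.
Proof.
move=> fg zy1 zy2 M M' a b ab h.
have [M1 [a' [b' [c [ses1 ses2 abE]]]]] := ses_preimage ab fg.
have [h1 h1E] := zy1 _ _ _ _ ses2 h; have [h2 h2E] := zy2 _ _ _ _ ses1 h1.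
by exists h2 => x; rewrite -abE h2E h1E.
Qed.

Lemma XV_zero Z Y : is_zero Z -> XV Z Y.
Proof.
move=> Z0 M M' a b [ai ab _] h; have as_ : msurj a by move=> y; apply/ab/Z0.
by have [x /ai->|h' h'E] := factor_surj (h := h) as_; [rewrite hom0|exists h'].
Qed.

(** The piece of the long exact sequence of Hom(Z, -) in use: pulling g back along h gives an
    extension of Z by Y, and a section of it provides the lift. *)
Lemma XV_lift Z Y V W (f : modhom Y V) (g : modhom V W) (h : modhom Z W) :
  XV Z Y -> ses f g -> exists h' : modhom Z V, forall z, g (h' z) = h z.
Proof.
move=> zy fg; have [B [j [b1 [b2 [jb _ bE _ _]]]]] := ses_pullback h fg.
have [r rK] := XV_split zy jb; have [s [sK _]] := ses_section jb rK.
by exists (comp_hom b1 s) => z; rewrite comp_homE bE sK.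
Qed.

(** An extension of D Y by D Z dualises to one of Z by Y, up to biduality. Its retraction is D s for
    some s by fullness, and s is a section of the original sequence by faithfulness. *)
Lemma XV_dual (D : cofunctor A) (hD : simple_preserving_duality D) Z Y :
  XV Z Y -> XV (D Y) (D Z).
Proof.
move=> zy; have {}zy := XV_iso (bidual_iso hD Z) (bidual_iso hD Y) zy.
apply: XV_of_split => W a b ab.
have [r rK] := XV_split zy (dual_ses hD ab); have [s sE] := dual_full hD r.
apply: (ses_retract (s := s) ab) => y; rewrite -comp_homE -[RHS]id_homE.
apply: (dual_faithful hD) => z.
by rewrite cmap_comp comp_homE sE rK cmap_id id_homE.
Qed.

Lemma ex_dmap X Y X' Y' (f : modhom X X') (g : modhom Y Y') :
  exists h : modhom (dsum X Y) (dsum X' Y'), forall x y, h (x, y) = (f x, g y).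
Proof.
have [h hE] := ex_pair (comp_hom f (pr1 X Y)) (comp_hom g (pr2 X Y)).
by exists h => x y; rewrite hE !comp_homE pr1E pr2E.
Qed.

Lemma dsumC X Y : iso (dsum X Y) (dsum Y X).
Proof.
have [h hE] := ex_pair (pr2 X Y) (pr1 X Y).
have {}hE x y : h (x, y) = (y, x) by rewrite hE pr1E pr2E.
apply: (@bij_iso _ _ _ _ h) => [[x y]|[y x]]; last by exists (x, y).
by rewrite hE => -[-> ->].
Qed.

(** A list whose span has maximal dimension: adjoining any further homomorphism leaves the span
    unchanged. *)
Lemma ex_modhom_span X Y : exists gs : seq (modhom X Y), forall g : modhom X Y,
  hom_fun g \in <<[seq hom_fun h | h <- gs]>>%VS.
Proof.
pose Q n := `[< exists gs : seq (modhom X Y), \dim <<[seq hom_fun h | h <- gs]>> = n >].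
have Q0 : exists n, Q n by eexists; apply/asboolP; exists [::].
have Qb n : Q n -> (n <= \dim {:'Hom(X, Y)})%N by move=> /asboolP[gs <-]; apply/dimvS/subvf.
case: (ex_maxnP Q0 Qb) => n /asboolP[gs gsn] maxn; exists gs => g.
have /maxn : Q (\dim <<[seq hom_fun h | h <- g :: gs]>>) by apply/asboolP; exists (g :: gs).
rewrite -gsn /= span_cons => le_dim.
have /eqP-> : (<<[seq hom_fun h | h <- gs]>> == <[hom_fun g]> + <<[seq hom_fun h | h <- gs]>>)%VS.
  by rewrite eqEdim addvSr le_dim.
exact: (subvP (addvSl _ _) _ (memv_line _)).
Qed.

End Extensions.

(** * Extremal elements in a finite poset *)

Section Poset.
Variables (d : Order.disp_t) (Lam : finPOrderType d) (Q : Lam -> Prop).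

Lemma ex_maximal l : Q l -> exists m, Q m /\ forall n, (m < n)%O -> ~ Q n.
Proof.
have [k] := ubnP #|[set n | (l < n)%O]|; elim: k l => // k IH l lk Ql.
have [[m [lm Qm]]|H] := pselect (exists m, (l < m)%O /\ Q m); last first.
  by exists l; split=> // n ln Qn; apply: H; exists n.
apply: (IH m) => //; rewrite -ltnS; apply: leq_trans lk; rewrite ltnS.
apply: proper_card; apply/properP; split.
  by apply/subsetP=> n; rewrite !inE; apply: lt_trans.
by exists m; rewrite !inE // ltxx.
Qed.

End Poset.

Lemma ex_minimal (d : Order.disp_t) (Lam : finPOrderType d) (Q : Lam -> Prop) l :
  Q l -> exists m, Q m /\ forall n, (n < m)%O -> ~ Q n.
Proof. exact: (@ex_maximal _ (Lam^d)%type). Qed.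

(** * Modules with a standard filtration *)

Section StandardFiltrations.
Local Open Scope ring_scope.
Variables (K : fieldType) (A : falgType K).
Variables (d : Order.disp_t) (Lam : finPOrderType d).
Variable L : Lam -> fdmod A.
Hypothesis hL : simples_representatives L.
Variables (P : Lam -> fdmod A) (p : forall l, modhom (P l) (L l)).
Hypothesis hP : forall l, projective_cover (p l).
Hypothesis hqh : quasi_hereditary p.
Implicit Types M N X Y Z W V : fdmod A.

Local Notation Delta := (std P).
Local Notation wt := (wt P).
Local Notation FD := (FD P).
Local Notation stdinc := (stdinc P).
Local Notation stdpi := (stdpi P).

Definition maxwt l M := forall m, (l < m)%O -> ~ wt m M.

Lemma ex_maxwt M : ~ is_zero M -> exists l, wt l M /\ maxwt l M.
Proof. by case/(ex_wt hL hP)=> l lM; apply: (@ex_maximal _ _ (wt^~ M) l). Qed.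

(** Induction on the filtration, with top factor Delta k and kernel X. If f lands in X, the cokernel
    of f is an extension of Delta k by that of Delta l -> X. Otherwise Delta l -> Delta k is
    nonzero, so l <= k, and maximality of l gives k = l. This endomorphism of Delta l is bijective,
    hence X is a complement of the image of f and isomorphic to the cokernel. *)
Lemma FD_max_hom M l (f : modhom (Delta l) M) x : FD M -> maxwt l M -> f x <> 0 ->
  minj f /\ forall Q (q : modhom M Q), msurj q -> kerim f q -> FD Q.
Proof.
move=> FM; elim: FM f x => {M} [M M0|X M k a b _ FX IH ab] f x lM fx.
  by case: fx.
have [ai ak bs] := ab; have [bf|] := pselect (forall y, b (f y) = 0).
  have [y|f' f'E] := factor_inj (h := f) ai; first exact/ak.
  have [fi' FQ'] : minj f' /\ forall Q (q : modhom X Q), msurj q -> kerim f' q -> FD Q.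
    apply: (IH f' x); last by move=> e; apply: fx; rewrite -f'E e hom0.
    by move=> m lm /(wt_sub ai); apply: lM.
  have fi : minj f by move=> y; rewrite -f'E => /ai/fi'.
  split=> // Q q qs qk; have [R [r [rs rk]]] := ex_coker f'.
  have [y|c [e ce]] := ses_coker_comp ab _ qs rk rs.
    by rewrite qk; split=> -[z <-]; exists z; rewrite comp_homE f'E.
  exact: (filt_step (isT : xpredT k) (FQ' _ _ rs rk) ce).
case/existsNP=> y bfy.
have lk : (l <= k)%O.
  by apply: (wt_std hL hP hqh); apply: (std_hom_wt (f := comp_hom b f) (x := y)); rewrite comp_homE.
have ekl : k = l.
  apply/eqP; rewrite eq_sym; move: lk; rewrite le_eqVlt => /orP[//|/lM[]].
  exact: (wt_quot hP bs (wt_std_self hL hP hqh k)).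
subst k.
have [] := @std_endo _ _ _ _ _ hL _ _ hP hqh l (comp_hom b f) y; rewrite ?comp_homE // => bfi bfs.
split=> [z fz|Q q qs qk]; first by apply: bfi; rewrite comp_homE fz hom0.
apply: filt_iso FX; apply: (@bij_iso _ _ _ _ (comp_hom q a)) => [z|z].
  rewrite comp_homE => /qk[w wE]; apply: ai; rewrite -wE.
  have -> : w = 0; last exact: hom0.
  by apply: bfi; rewrite comp_homE wE (ses_comp0 _ ak).
have [m <-] := qs z; have [w wE] := bfs (b m).
have /ak[u uE] : b (m - f w) = 0 by rewrite homB -wE comp_homE subrr.
by exists u; rewrite comp_homE uE homB (ses_comp0 _ qk) subr0.
Qed.

Lemma FD_dsum X Y : FD X -> FD Y -> FD (dsum X Y).
Proof. exact: filt_ext (ses_dsum X Y). Qed.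

(** A maximal weight l of the sum occurs in X or in Y, and Delta l then embeds in that summand. By
    [FD_max_hom] the sum stays in F(Delta) after dividing by Delta l, so induction on the dimension
    applies. *)
Lemma FD_summand X Y : FD (dsum X Y) -> FD X.
Proof.
have [n] := ubnP (mdim (dsum X Y)); elim: n X Y => // n IH X Y; rewrite ltnS => dn F.
have [z|nz] := pselect (is_zero (dsum X Y)).
  by apply: filt_zero => x; have := z (x, 0) => -[].
have [l [lM lmax]] := ex_maxwt nz.
have std_pos : (0 < mdim (Delta l))%N.
  rewrite lt0n; apply/eqP=> /mdim0 z.
  exact: wt_nz (wt_std_self hL hP hqh l) z.
have sub_max N (i : modhom N (dsum X Y)) : minj i -> maxwt l N.
  by move=> ii m lm /(wt_sub ii); apply: lmax.
have [i1 i2] : minj (ds1 X Y) /\ minj (ds2 X Y).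
  by split=> x; rewrite ?ds1E ?ds2E => -[].
have [/wt_std_hom/(_ (sub_max _ _ i1))[f [x fx]]|/wt_std_hom/(_ (sub_max _ _ i2))[f [x fx]]]
  := wt_ses (ses_dsum X Y) lM.
- have [|fi FQ] := @FD_max_hom _ _ (comp_hom (ds1 X Y) f) x F lmax.
    by rewrite comp_homE => /i1.
  have [Z [q fq]] : exists Z (q : modhom X Z), ses f q.
    by apply: ses_coker => y fy; apply: fi; rewrite comp_homE fy hom0.
  have [h hE] := ex_dmap q (id_hom Y).
  have FZ : FD (dsum Z Y).
    apply: (FQ _ h) => [[z y]|[z y]]; case: fq => _ fk qs.
      by have [w <-] := qs z; exists (w, y); rewrite hE id_homE.
    rewrite hE id_homE; split=> [[/fk[w <-] ->]|[w]].
      by exists w; rewrite comp_homE ds1E.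
    by rewrite comp_homE ds1E => -[<- <-]; rewrite (ses_comp0 _ fk).
  apply: (filt_ext fq (FD_std P l)); apply: IH FZ.
  apply: leq_trans dn; rewrite !mdim_dsum (mdim_ses fq) -addnA.
  by rewrite -{1}[(mdim Z + _)%N]add0n ltn_add2r.
- have [|fi FQ] := @FD_max_hom _ _ (comp_hom (ds2 X Y) f) x F lmax.
    by rewrite comp_homE => /i2.
  have [Z [q fq]] : exists Z (q : modhom Y Z), ses f q.
    by apply: ses_coker => y fy; apply: fi; rewrite comp_homE fy hom0.
  have [h hE] := ex_dmap (id_hom X) q.
  have FZ : FD (dsum X Z).
    apply: (FQ _ h) => [[z y]|[z y]]; case: fq => _ fk qs.
      by have [w <-] := qs y; exists (z, w); rewrite hE id_homE.
    rewrite hE id_homE; split=> [[-> /fk[w <-]]|[w]].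
      by exists w; rewrite comp_homE ds2E.
    by rewrite comp_homE ds2E => -[<- <-]; rewrite (ses_comp0 _ fk).
  apply: IH _ FZ.
  apply: leq_trans dn; rewrite !mdim_dsum (mdim_ses fq) ltn_add2l.
  by rewrite -{1}[mdim Z]add0n ltn_add2r.
Qed.

Lemma XV_FD_l Z Y : (forall l, XV (Delta l) Y) -> FD Z -> XV Z Y.
Proof.
move=> H; elim=> {Z} [Z Z0|X Z k a b _ _ IH ab]; first exact: XV_zero.
exact: XV_ext ab IH (H k).
Qed.

(** As P l is projective, Ext^1(Delta l, Y) is the cokernel of the restriction from Hom(P l, Y) to
    Hom([stdker P l], Y). *)
Lemma XV_std l Y :
  (forall g : modhom (stdker P l) Y, exists e : modhom (P l) Y,
     forall x, e (stdinc l x) = g x) -> XV (Delta l) Y.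
Proof.
move=> H M M' a b [ai ab bs] h; have [ki kk ks] := std_ses P l.
have [t tE] := proj_lift (stdpi l) (cover_proj hP (l := l)) bs.
have [x|t0 t0E] := factor_inj (h := comp_hom t (stdinc l)) ai.
  by apply/ab; rewrite comp_homE tE (ses_comp0 _ kk).
have [e eE] := H (comp_hom h t0).
(* M' is a quotient of the direct sum of M and P l through [u]; the map [v] given by h and [e]
   vanishes on the kernel of [u] and descends to M'. *)
have [u uE] := ex_copair a t; have [v vE] := ex_copair h e.
have us : msurj u.
  move=> m; have [x xE] := ks (b m).
  have /ab[y yE] : b (m - t x) = 0 by rewrite homB tE xE subrr.
  by exists (y, x); rewrite uE yE subrK.
have [[m x]|h' h'E] := factor_surj (h := v) us.
  rewrite uE vE => e0.
  have /kk[y yE] : stdpi l x = 0.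
    by move: (congr1 b e0); rewrite homD (ses_comp0 _ ab) add0r tE hom0.
  move: e0; rewrite -yE -comp_homE -t0E -homD => /ai my.
  by rewrite eE comp_homE -homD my hom0.
by exists h' => x; move: (h'E (x, 0)); rewrite uE vE !hom0 !addr0.
Qed.

Section WithDuality.
Variables (D : cofunctor A) (hD : simple_preserving_duality D).

Lemma XV_std_dstd l m : XV (Delta l) (D (Delta m)).
Proof.
(* Weights of [D (Delta n)] are at most n, so a weight above k would give k < n; hence all maps from
   [stdker P k] to it vanish. *)
have main k n : ~~ (k < n)%O -> XV (Delta k) (D (Delta n)).
  move=> kn; apply: XV_std => g; exists (hom_zero _ _) => x.
  rewrite hom_zeroE stdker_hom0 // => j kj /(wt_dualV hL hP hD)/(wt_std hL hP hqh) jn.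
  by move: kn; rewrite (lt_le_trans kj jn).
(* If l < m then not m < l, and the claim is dual to the case already treated. *)
have [lm|] := boolP (l < m)%O; last exact: main.
have /main/(XV_dual hD) : ~~ (m < l)%O by rewrite lt_gtF.
by apply: XV_iso; [apply/iso_sym/bidual_iso | apply: iso_refl].
Qed.

(** Reduction to standard modules in the first argument by their filtrations, then in the second
    argument after exchanging the two by duality. *)
Lemma XV_FD Z Y : FD Z -> FD (D Y) -> XV Z Y.
Proof.
move=> FZ FY; apply: XV_FD_l FZ => l.
have /(XV_dual hD) : XV (D Y) (D (Delta l)) by apply: XV_FD_l FY => m; apply: XV_std_dstd.
by apply: XV_iso; apply/iso_sym/bidual_iso.
Qed.

(** The last clause says that L l is essential. A nonzero kernel U of e has weight l, since D U is a
    quotient of Delta l up to biduality; but U meets L l trivially, so it embeds in R, whose weights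
    are below l. *)
Lemma dstd_socle l : exists R (f : modhom (L l) (D (Delta l))) (g : modhom (D (Delta l)) R),
  [/\ ses f g, forall m, wt m R -> (m < l)%O &
      forall V (e : modhom (D (Delta l)) V), minj (comp_hom e f) -> minj e].
Proof.
have [R [r rq]] := ses_ker (@stdq_surj _ _ _ _ _ hL _ _ hP hqh l).
have Rl m : wt m (D R) -> (m < l)%O.
  by case: rq => ri rk _ /(wt_dualV hL hP hD)/(stdq_ker ri rk).
have [|f fg] := ses_iso_l (X' := L l) (dual_ses hD rq).
  by apply/iso_sym/(dual_simple hD)/(simpleL hL).
exists (D R), f, (cmap D r); split=> // V e efi.
have [U [u [ui uk]]] := ex_ker e; apply: contrapT => ne.
have nU : ~ is_zero U.
  by move=> U0; apply: ne => x /uk[y <-]; rewrite (U0 y) hom0.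
have wU : wt l U.
  apply: (wt_dualV hL hP hD); have /iso_bij[b [_ bs]] := bidual_iso hD (Delta l).
  have us := dual_inj hD ui; have [y y0] : exists y : D U, y <> 0.
    by apply: not_is_zero => /(dual_is_zeroV hD).
  have [x xE] := us y; have [z zE] := bs x.
  by apply: (std_hom_wt (f := comp_hom (cmap D u) b) (x := z)); rewrite comp_homE zE xE.
suff gi : minj (comp_hom (cmap D r) u) by have := Rl _ (wt_sub gi wU); rewrite ltxx.
case: fg => _ fk _ x; rewrite comp_homE => /fk[y yE]; apply: ui; rewrite -yE.
have -> : y = 0; last exact: hom0.
by apply: efi; rewrite comp_homE yE (ses_comp0 _ uk).
Qed.

(** * Modules without extensions by standard modules, and the minimal weights of their socles *)

Section Criterion.
Variables (V : fdmod A) (l : Lam).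
Hypothesis XV_V : forall m, XV (Delta m) V.
Hypothesis l_min : forall m, (m < l)%O -> ~ exists i : modhom (L m) V, minj i.

(** A nonzero image would contain some L m with m a weight of Z, hence m < l, in the socle of V. *)
Lemma hom_small0 Z (g : modhom Z V) : (forall m, wt m Z -> (m < l)%O) -> forall x, g x = 0.
Proof.
move=> Zl x; apply: contrapT => gx; have [Y [s [i [ss ii siE]]]] := ex_img g.
have [|m [j ji]] := @ex_L_sub _ _ _ _ hL Y.
  by move=> Y0; apply: gx; rewrite -siE (Y0 (s x)) hom0.
apply: (@l_min m); last by exists (comp_hom i j); apply: minj_comp.
by apply/Zl/(wt_quot hP ss)/(wt_sub ji)/(wtL hL hP).
Qed.

(** Pull the sequence back along Delta m -> L m. There h extends, and the extension descends to M':
    the kernel of B -> M' embeds in that of Delta m -> L m, whose weights are below m, so it has no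
    nonzero map to V. *)
Lemma XV_small_simple m : (m < l)%O -> XV (L m) V.
Proof.
move=> ml M M' a b ab h.
have [B [j [b1 [b2 [jb b1j bE B1 B2]]]]] := ses_pullback (stdq hL hP hqh m) ab.
have b1s : msurj b1.
  move=> y; have [z zE] := @stdq_surj _ _ _ _ _ hL _ _ hP hqh m (b y).
  by have [x [<- _]] := B1 y z (esym zE); exists x.
have [e eE] := XV_V jb h; have [U [u [ui uk]]] := ex_ker b1.
have [R [i [ii iq iqs]]] := ses_ker (@stdq_surj _ _ _ _ _ hL _ _ hP hqh m).
have [x|w wE] := factor_inj (h := comp_hom b2 u) ii.
  by apply/iq; rewrite comp_homE -bE (ses_comp0 _ uk) hom0.
have wi : minj w.
  move=> x wx; apply/ui/B2; first exact: (ses_comp0 _ uk).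
  by rewrite -comp_homE -wE wx hom0.
have eu0 x : e (u x) = 0.
  rewrite -comp_homE; apply: hom_small0 => k /(wt_sub wi)/(stdq_ker ii iq) km.
  exact: lt_trans km ml.
have [x /uk[y <-]//|h' h'E] := factor_surj (h := e) b1s.
by exists h' => x; rewrite -b1j h'E eE.
Qed.

Lemma XV_small Z : (forall m, wt m Z -> (m < l)%O) -> XV Z V.
Proof.
have [n] := ubnP (mdim Z); elim: n Z => // n IH Z dZ Zl.
have [|/(ex_L_sub hL)[m [i ii]]] := pselect (is_zero Z); first exact: XV_zero.
have [Q [q iq]] := ses_coker ii; apply: (XV_ext iq).
  by apply/XV_small_simple/Zl/(wt_sub ii)/(wtL hL hP).
apply: IH => [|m' wm]; last by case: iq => _ _ qs; apply: Zl; apply: wt_quot hP _ _ _ _ qs wm.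
rewrite -ltnS; apply: leq_trans dZ; rewrite ltnS (mdim_ses_lt iq) //.
exact: (wt_nz (wtL hL hP m)).
Qed.

(** The quotient of [D (Delta l)] by its socle L l has only weights below l, so i extends; the
    extension is injective because the socle is essential. *)
Lemma dstd_embedding (i : modhom (L l) V) : minj i ->
  exists e : modhom (D (Delta l)) V, minj e.
Proof.
move=> ii; have [R [f [g [fg Rl ess]]]] := dstd_socle l.
have [e eE] := XV_small Rl fg i; exists e.
by apply: ess => x; rewrite comp_homE eE; apply: ii.
Qed.

End Criterion.
(* Induction on V: for l minimal with [L l] in the socle of V, that copy of [L l]
   extends to an embedding of [D (Delta l)], whose cokernel inherits the hypothesis. *)
Lemma XV_FD_r V : (forall l, XV (Delta l) V) -> FD (D V).
Proof.
have [n] := ubnP (mdim V); elim: n V => // n IH V dV HV.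
have [V0|/(ex_L_sub hL)[l0 l0V]] := pselect (is_zero V).
  exact/filt_zero/(dual_is_zero hD).
have [l [[i ii] lmin]] := @ex_minimal _ _ (fun l => exists i : modhom (L l) V, minj i) _ l0V.
have [e ei] := dstd_embedding HV lmin ii.
have [W [w ew]] := ses_coker ei.
have FW : FD (D W).
  apply: IH => [|m].
    rewrite -ltnS; apply: leq_trans dV; rewrite ltnS (mdim_ses_lt ew) //.
    by move/(dual_is_zeroV hD); apply: (wt_nz (wt_std_self hL hP hqh l)).
  apply: XV_std => g.
  (* A map from [stdker P m] to the cokernel W lifts to V, because Ext^1([stdker P m],
     [D (Delta l)]) = 0; the lift extends to P m because Ext^1(Delta m, V) = 0. *)
  have [|h hE] := XV_lift g _ ew.
    apply: XV_FD; first exact: (FD_stdker hqh).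
    exact: filt_iso (bidual_iso hD _) (FD_std P l).
  have [u uE] := HV m _ _ _ _ (std_ses P m) h.
  by exists (comp_hom w u) => x; rewrite comp_homE uE hE.
apply: (filt_ext (dual_ses hD ew) FW).
exact: filt_iso (bidual_iso hD _) (FD_std P l).
Qed.

(** For each homomorphism in the list, a pushout along [stdker P l] -> P l makes it extend to P l
    and adds one factor Delta l to the cokernel. Linear combinations then extend as well. *)
Lemma ex_extension_span l M (gs : seq (modhom (stdker P l) M)) :
  exists M' C (a : modhom M M') (c : modhom M' C),
  [/\ ses a c, FD C, forall m, wt m C -> (m <= l)%O &
      forall g, hom_fun g \in <<[seq hom_fun h | h <- gs]>>%VS ->
        exists e : modhom (P l) M', forall x, e (stdinc l x) = a (g x)].
Proof.
elim: gs => [|x gs [M1 [C1 [a1 [c1 [ac1 F1 w1 H1]]]]]].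
  exists M, (zero_mod A), (id_hom M), (hom_zero _ _); split.
  - exact: ses_id_zero.
  - exact/filt_zero/zero_mod_zero.
  - by move=> m wm; case: (wt_nz wm (@zero_mod_zero _ A)).
  move=> g; rewrite /= span_nil memv0 => /eqP g0.
  by exists (hom_zero _ _) => y; rewrite id_homE hom_zeroE g0 lfunE.
have [B [b1 [b2 [w [bw bE _]]]]] := ses_pushout (comp_hom a1 x) (std_ses P l).
have [C [c [cs ck]]] := ex_coker (comp_hom b2 a1).
have [_ ck1 cs1] := ac1.
have [u [v uv]] := ses_coker_comp bw ck cs ck1 cs1.
exists B, C, (comp_hom b2 a1), c; split.
- by split=> //; apply: minj_comp; [case: bw|case: ac1].
- exact: (filt_step (isT : xpredT l) F1 uv).
- by move=> m /(wt_ses uv)[/w1//|/(wt_std hL hP hqh)].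
move=> g; rewrite /= span_cons => /memv_addP[_ /vlineP[k ->] [h hs gE]].
(* Here g = k x + h: the summand h = g - k x extends by induction, and k x extends through [b1]. *)
have [|e eE] := H1 (hom_comb (- k) x g).
  suff -> : hom_fun (hom_comb (- k) x g) = h by [].
  by rewrite /= gE addrA scaleNr addNr add0r.
exists (hom_comb k b1 (comp_hom b2 e)) => y.
rewrite hom_combE comp_homE eE bE !comp_homE hom_combE -linearP /=.
congr (hom_fun b2 _); rewrite -linearP /=; congr (hom_fun a1 _).
by rewrite addrA scaleNr subrr add0r.
Qed.

Lemma ex_univ_extension l M :
  exists M' C (a : modhom M M') (c : modhom M' C),
  [/\ ses a c, FD C, forall m, wt m C -> (m <= l)%O &
      forall g : modhom (stdker P l) M,
        exists e : modhom (P l) M', forall x, e (stdinc l x) = a (g x)].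
Proof.
have [gs gsP] := ex_modhom_span (stdker P l) M.
have [M' [C [a [c [? ? ? H]]]]] := ex_extension_span gs.
by exists M', C, a, c; split=> // g; apply: H.
Qed.

(* Universal extensions by [Delta l], from larger to smaller l: those for a minimal l
   create no extension problem for the other elements of G. *)
Lemma ex_XV_extension (G : {set Lam}) M :
  (forall l m, l \in G -> (l < m)%O -> m \in G) ->
  exists M' C (a : modhom M M') (c : modhom M' C),
  [/\ ses a c, FD C & forall l, l \in G ->
      forall g : modhom (stdker P l) M', exists e : modhom (P l) M',
        forall x, e (stdinc l x) = g x].
Proof.
have [n] := ubnP #|G|; elim: n G => // n IH G Gn up.
have [->|[l0 l0G]] := set_0Vmem G.
  exists M, (zero_mod A), (id_hom M), (hom_zero _ _); split.
  - exact: ses_id_zero.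
  - exact/filt_zero/zero_mod_zero.
  by move=> l; rewrite inE.
have [l [lG lmin]] := @ex_minimal _ _ (fun l => l \in G) _ l0G.
have [||M1 [C1 [a1 [c1 [ac1 F1 H1]]]]] := IH (G :\ l).
- by rewrite -ltnS; apply: leq_trans Gn; rewrite (cardsD1 l G) lG.
- move=> k m; rewrite !inE => /andP[_ kG] km; rewrite (up _ _ kG km) andbT.
  by apply/eqP=> ml; apply: (lmin k); rewrite -?ml.
have [M' [C' [a' [c' [ac' F' w' H']]]]] := ex_univ_extension l M1.
have [C [c [cs ck]]] := ex_coker (comp_hom a' a1).
have [_ ck1 cs1] := ac1.
have [u [v uv]] := ses_coker_comp ac' ck cs ck1 cs1.
have [ai' ak' as'] := ac'.
exists M', C, (comp_hom a' a1), c; split.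
- by split=> //; apply: minj_comp => //; case: ac1.
- exact: filt_ext uv F1 F'.
move=> k kG g.
(* Weights of C' are at most l. One above k would give k < l, against the minimality of l in G; so g
   lands in [M1], where the earlier extensions apply. *)
have cg0 x : c' (g x) = 0.
  rewrite -comp_homE; apply: stdker_hom0 => m km /w' ml.
  by apply: (lmin k); first exact: lt_le_trans ml.
have [x|g1 g1E] := factor_inj (h := g) ai'; first exact/ak'.
have [kl|kl] := eqVneq k l.
  subst k; have [e eE] := H' g1; exists e => x; by rewrite eE g1E.
have [|e eE] := H1 k _ g1; first by rewrite !inE kl.
by exists (comp_hom a' e) => x; rewrite comp_homE eE g1E.
Qed.

(* [D] exchanges F(Delta) and F(nabla), see [filt_costdP]. *)
Definition tilt M := FD M /\ FD (D M).

(** Taking all weights for G makes Ext^1(Delta l, T) vanish for every l, so D T lies in F(Delta) by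
    [XV_FD_r]; T itself is an extension of C by M. *)
Lemma ex_tilt_embedding M : FD M ->
  exists T C (a : modhom M T) (c : modhom T C), [/\ ses a c, FD C & tilt T].
Proof.
move=> FM; have [|T [C [a [c [ac FC H]]]]] := @ex_XV_extension setT M; first by move=> *; rewrite inE.
exists T, C, a, c; split=> //; split; first exact: filt_ext ac FM FC.
by apply: XV_FD_r => l; apply/XV_std/H.
Qed.

Lemma tilt_iso M N : iso M N -> tilt M -> tilt N.
Proof.
by move=> MN [F1 F2]; split; [apply: filt_iso MN F1|apply: filt_iso (dual_iso D MN) F2].
Qed.

Lemma dual_dsum X Y : iso (D (dsum X Y)) (dsum (D Y) (D X)).
Proof.
apply: (split_iso (dual_ses hD (ses_dsum X Y)) (r := cmap D (ds2 X Y))) => x.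
rewrite (@dual_comp _ _ D _ _ _ _ _ (id_hom Y)) ?dual_id // => y; rewrite id_homE //.
by rewrite pr2E ds2E.
Qed.

Lemma tilt_dsum X Y : tilt X -> tilt Y -> tilt (dsum X Y).
Proof.
move=> [X1 X2] [Y1 Y2]; split; first exact: FD_dsum.
exact: filt_iso (iso_sym (dual_dsum X Y)) (FD_dsum Y2 X2).
Qed.

Lemma tilt_summand X Y : tilt (dsum X Y) -> tilt X.
Proof.
move=> [F1 F2]; split; first exact: FD_summand F1.
apply: FD_summand (filt_iso _ F2).
exact: iso_trans (dual_dsum X Y) (dsumC _ _).
Qed.

Lemma tilt_dual X : tilt X -> tilt (D X).
Proof. by case=> F1 F2; split=> //; apply: filt_iso (bidual_iso hD X) F1. Qed.

End WithDuality.
End StandardFiltrations.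

(** * Composition factors and weights *)

Section CompositionFactors.
Local Open Scope ring_scope.
Variables (K : fieldType) (A : falgType K) (Lam : eqType).
Variable L : Lam -> fdmod A.
Hypothesis hL : simples_representatives L.
Variables (P : Lam -> fdmod A) (p : forall l, modhom (P l) (L l)).
Hypothesis hP : forall l, projective_cover (p l).
Implicit Types M N X Y Z W V : fdmod A.

Lemma filtL_any X : filt L xpredT X.
Proof.
have [n] := ubnP (mdim X); elim: n X => // n IH X dX.
have [|/(ex_L_sub hL)[l [i ii]]] := pselect (is_zero X); first exact: filt_zero.
have [Q [q iq]] := ses_coker ii; apply: (filt_ext iq); first exact: filt_one.
apply: IH; rewrite -ltnS; apply: leq_trans dX; rewrite ltnS (mdim_ses_lt iq) //.
exact: (wt_nz (wtL hL hP l)).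
Qed.

(** For the converse: if a filtration of X with simple factors had no factor L m, all weights of X
    would differ from m by [filtL_wt]. *)
Lemma composition_factorP M (V : submod M) X (i : modhom X M) m :
  minj i -> (forall x, x \in submod_space V <-> exists y, i y = x) ->
  composition_factor V (L m) <-> wt P m X.
Proof.
move=> ii iV; split=> [[n [F [[F0 Fn Fs] _ [k kn kL]]]]|wX].
  have [u [ui uF]] := submod_modP (F k.+1).
  have [s [ss _]] := subquotP (F k) uF.
  have FkV : (F k.+1 <= V)%VS.
    rewrite -Fn; have: (k.+1 <= n)%N by [].
    move: {kn kL u ui uF s ss}(k.+1) => j; elim: n Fs {Fn} => [|n IH] Fs.
      by rewrite leqn0 => /eqP->.
    rewrite leq_eqVlt => /orP[/eqP->//|jn].
    apply: (subv_trans (IH _ jn)) => [k0 kn|]; last exact: Fs.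
    by apply: Fs; apply: ltnW.
  have [x|w wE] := factor_inj (h := u) ii.
    by apply/iV/(subvP FkV)/uF; exists x.
  have wi : minj w by move=> x wx; apply: ui; rewrite -wE wx hom0.
  apply: (wt_sub wi); apply: (wt_quot hP ss).
  by apply: wt_iso (iso_sym kL) (wtL hL hP m).
have [n [F [[F0 Fn Fs] FL]]] := filt_filtered_by ii iV (filtL_any X).
exists n, F; split=> // [k /FL[j _ jE]|].
  exact: simple_iso (simpleL hL j) (iso_sym jE).
apply: contrapT => nk.
suff : filt L (predC1 m) X by move/(filtL_wt hL hP)/(_ wX); rewrite /= eqxx.
apply: (filtered_by_filt ii iV); exists n, F; split=> // k kn.
have [j _ jE] := FL _ kn; exists j => //=; apply/eqP=> jm.
by apply: nk; exists k; rewrite -?jm.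
Qed.

End CompositionFactors.

(** * Costandard modules *)

Section Costandard.
Local Open Scope ring_scope.
Variables (K : fieldType) (A : falgType K).
Variables (d : Order.disp_t) (Lam : finPOrderType d).
Variable L : Lam -> fdmod A.
Hypothesis hL : simples_representatives L.
Variables (P : Lam -> fdmod A) (p : forall l, modhom (P l) (L l)).
Hypothesis hP : forall l, projective_cover (p l).
Hypothesis hqh : quasi_hereditary p.
Variables (D : cofunctor A) (hD : simple_preserving_duality D).
Variables (I : Lam -> fdmod A) (i : forall l, modhom (L l) (I l)).
Hypothesis hI : forall l, injective_hull (i l).
Variable N : forall l, submod (I l).
Hypothesis hN : forall l, is_costd L l (N l).
Implicit Types M X Y Z W V : fdmod A.

Local Notation Delta := (std P).
Local Notation wt := (wt P).
Local Notation FD := (FD P).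
Definition costd l := submod_mod (N l).

(** Dual to the projectivity of Delta l among modules without weights above l: for such a module Y,
    every map from [stdker P l] to Y is zero. *)
Lemma XV_dstd_max Z l : maxwt P l Z -> XV Z (D (Delta l)).
Proof.
move=> Zl; have : XV (Delta l) (D Z).
  apply: (XV_std hP) => g; exists (hom_zero _ _) => x.
  by rewrite hom_zeroE stdker_hom0 // => m lm /(wt_dualV hL hP hD); apply: Zl.
by move/(XV_dual hD); apply: XV_iso; [apply/iso_sym/bidual_iso | apply: iso_refl].
Qed.

(* Both modules have socle [L l], and each embeds in the other. *)
Lemma costd_iso l : iso (costd l) (D (Delta l)).
Proof.
have [R [f [g [fg Rl ess]]]] := dstd_socle hL hP hqh hD l.
have [inj_I ii small] := hI l; have [Nmax Nub] := hN l.
have [fi _ _] := fg.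
have [j jE] := inj_I _ _ f (i l) ((minjP f).1 fi).
have {}jE x : j (f x) = i l x by rewrite -jE comp_homE.
have ji : minj j by apply: ess => x; rewrite comp_homE jE; apply/minjP: x.
have [nu [nui nuN]] := submod_modP (N l).
have jN x : j x \in submod_space (N l).
  apply: (subvP (Nub (himg j) _)); last by apply/himgP; exists x.
  move=> m lm /(composition_factorP hL hP _ ji (@himgP _ _ _ _ j)).
  move=> /(wt_dualV hL hP hD)/(wt_std hL hP hqh).
  by move=> /(lt_le_trans lm); rewrite ltxx.
have [x|j' j'E] := factor_inj (h := j) nui; first exact/nuN/jN.
have j'i : minj j' by move=> x jx; apply: ji; rewrite -j'E jx hom0.
have Nl : maxwt P l (costd l).
  move=> m lm wN; apply: (Nmax m lm).
  exact/(composition_factorP hL hP m nui nuN).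
have fi' : minj (comp_hom j' f) by apply: minj_comp.
have [Q [q fq]] := ses_coker fi'.
(* The embedding of L l in [D (Delta l)] extends to the costandard module. The extension is
   injective, since its kernel meets L l trivially and L l is essential in I l. *)
have [|k kE] := XV_dstd_max (l := l) _ fq f.
  move=> m lm wQ; apply: (Nl m lm); case: fq => _ _ qs.
  exact: (wt_quot hP qs wQ).
have ki : minj k.
  have [U [u [ui uk]]] := ex_ker k.
  have nuk : (himg (comp_hom nu u) :&: limg (i l) = 0)%VS.
    apply/vspaceP=> x; rewrite memv_cap memv0; apply/andP/eqP=> [[]|->]; last by rewrite !mem0v.
    move=> /himgP[y <-] /memv_imgP[z _]; rewrite comp_homE -jE -j'E => /(minj_inj nui) uy.
    have : f z = 0 by rewrite -kE comp_homE -uy (ses_comp0 _ uk).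
    by rewrite uy => /fi ->; rewrite !hom0.
  have z := small _ nuk; move=> x /uk[y <-]; apply: nui; apply/eqP.
  by rewrite -memv0 -z; apply/himgP; exists y; rewrite comp_homE.
exact: bij_iso ki (minj_dim_surj ki (mdim_minj j'i)).
Qed.

Lemma filt_costdP M : filt costd xpredT M <-> FD (D M).
Proof.
have DD l : iso (D (costd l)) (Delta l).
  exact: iso_trans (dual_iso D (costd_iso l)) (iso_sym (bidual_iso hD _)).
have FZ Z : FD Z -> filt costd xpredT (D Z).
  elim=> {Z} [Z Z0|X Z k f g _ _ IH fg]; first exact/filt_zero/(dual_is_zero hD).
  apply: (filt_ext (dual_ses hD fg)) => //.
  by apply: filt_iso (costd_iso k) _; apply: filt_one.
split=> [|/FZ]; last by apply: filt_iso; apply/iso_sym/bidual_iso.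
elim=> {M} [M M0|X M k f g _ _ IH fg]; first exact/filt_zero/(dual_is_zero hD).
apply: (filt_ext (dual_ses hD fg)) => //.
exact: filt_iso (iso_sym (DD k)) (FD_std P k).
Qed.

Lemma tiltingP M : tilting Delta costd M <-> tilt P D M.
Proof. by rewrite /tilting -!filt_fullP filt_costdP. Qed.

End Costandard.

(** * The regular module *)

Section Regular.
Local Open Scope ring_scope.
Variables (K : fieldType) (A : falgType K).
Implicit Types M X Y Z W V : fdmod A.

Lemma amull_act1 (x : A) : amull 1 x = x.
Proof. by rewrite lfunE /= mul1r. Qed.
Lemma amull_actM (a b x : A) : amull (a * b) x = amull a (amull b x).
Proof. by rewrite !lfunE /= mulrA. Qed.
Definition regmod : fdmod A := @FdMod K A A (@amull K A) amull_act1 amull_actM.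

Lemma regmod_actE a (x : regmod) : act regmod a x = (a : A) * (x : A).
Proof. by rewrite lfunE. Qed.

Lemma ex_orbit_hom M (x : M) : exists h : modhom regmod M, forall a, h a = act M a x.
Proof.
have [k a b|a b|h hE] := @hom_of_fun _ _ regmod M (fun a => act M a x); last by exists h.
  by rewrite linearP add_lfunE scale_lfunE.
by rewrite regmod_actE actM.
Qed.

Lemma regmod_projective : projective regmod.
Proof.
move=> X Y g h /msurjP gs; have [x xE] := gs (h (1 : A)).
have [h' h'E] := ex_orbit_hom x; exists h'; apply: hom_ext => a.
by rewrite comp_homE h'E homP xE -homP regmod_actE mulr1.
Qed.

Lemma dsum_projective X Y : projective X -> projective Y -> projective (dsum X Y).
Proof.
move=> pX pY V W g h /msurjP gs.
have [u uE] := proj_lift (comp_hom h (ds1 X Y)) pX gs.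
have [v vE] := proj_lift (comp_hom h (ds2 X Y)) pY gs.
have [w wE] := ex_copair u v; exists w; apply: hom_ext => -[x y].
by rewrite comp_homE wE homD uE vE !comp_homE -homD dsum_eta.
Qed.

Variables (d : Order.disp_t) (Lam : finPOrderType d).
Variable L : Lam -> fdmod A.
Hypothesis hL : simples_representatives L.
Variables (P : Lam -> fdmod A) (p : forall l, modhom (P l) (L l)).
Hypothesis hP : forall l, projective_cover (p l).
Hypothesis hqh : quasi_hereditary p.

Lemma ex_projective_FD M : exists Q (q : modhom Q M),
  [/\ projective Q, FD P Q & msurj q].
Proof.
have [n] := ubnP (mdim M); elim: n M => // n IH M dM.
have [M0|/(ex_L_sub hL)[l [i ii]]] := pselect (is_zero M).
  exists (zero_mod A), (hom_zero _ _); split; last by move=> y; exists 0; rewrite hom0 (M0 y).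
    move=> X Y g h _; exists (hom_zero _ _); apply: hom_ext => x.
    by rewrite (zero_mod_zero x) !hom0.
  exact/filt_zero/zero_mod_zero.
have [C [c ic]] := ses_coker ii; have [_ ck cs] := ic.
have [|Q [q [pQ FQ qs]]] := IH C.
  rewrite -ltnS; apply: leq_trans dM; rewrite ltnS (mdim_ses_lt ic) //.
  exact: (wt_nz (wtL hL hP l)).
have [t tE] := proj_lift q pQ cs; have [u uE] := ex_copair (comp_hom i (p l)) t.
exists (dsum (P l) Q), u; split.
- by apply: dsum_projective => //; apply: (cover_proj hP (l := l)).
- exact: FD_dsum (FD_P hqh l) FQ.
move=> m; have [y yE] := qs (c m).
have /ck[z zE] : c (m - t y) = 0 by rewrite homB tE yE subrr.
have [x xE] := cover_surj hP z.
by exists (x, y); rewrite uE comp_homE xE zE subrK.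
Qed.

(** The regular module is projective, hence a summand of any module of F(Delta) mapping onto it. *)
Lemma regmod_FD : FD P regmod.
Proof.
have [Q [q [pQ FQ qs]]] := ex_projective_FD regmod.
have [s sE] := proj_lift (id_hom regmod) regmod_projective qs.
have {}sE x : q (s x) = x by rewrite sE id_homE.
have [X [f fq]] := ses_ker qs; have [r rK] := ses_retract fq sE.
apply: (FD_summand hL hP hqh (Y := X)).
by apply: filt_iso FQ; apply: iso_trans (split_iso fq rK) (dsumC _ _).
Qed.

End Regular.

(** * Indecomposable modules *)

Section Indecomposables.
Local Open Scope ring_scope.
Variables (K : fieldType) (A : falgType K).
Implicit Types M N X Y Z W : fdmod A.

Lemma bij_inv M N (f : modhom M N) : minj f -> msurj f ->
  exists g : modhom N M, (forall x, g (f x) = x) /\ (forall y, f (g y) = y).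
Proof.
move=> fi fs; have [x /fi->|g gE] := factor_surj (h := id_hom M) fs; first exact: hom0.
exists g; split=> [x|y]; first by rewrite gE id_homE.
by have [x <-] := fs y; rewrite gE id_homE.
Qed.

Lemma indecomposable_retract X Y (f : modhom X Y) (r : modhom Y X) :
  ~ is_zero X -> indecomposable Y -> (forall x, r (f x) = x) -> iso X Y.
Proof.
move=> X0 [_ Yi] rK; have [Z [g fg]] := ex_complement rK.
have [|] := Yi _ _ (split_iso fg rK); first by rewrite nonzeroP => /contrapT.
by rewrite nonzeroP => /contrapT/(ses_zero_r fg).
Qed.

Fixpoint hpow X (u : modhom X X) n : modhom X X :=
  if n is n'.+1 then comp_hom u (hpow u n') else id_hom X.

Lemma hpowE X (u : modhom X X) n x : hpow u n x = iter n u x.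
Proof. by elim: n => [|n IH] /=; rewrite ?id_lfunE // comp_lfunE IH. Qed.

(** When the rank of v = u^(n+1) is minimal, v and its square have the same image, so v is bijective
    on its image and the image is a summand: it is zero or all of X. *)
Lemma fitting X (u : modhom X X) : indecomposable X ->
  (minj u /\ msurj u) \/ exists n, forall x, iter n u x = 0.
Proof.
move=> [_ Xi]; pose r n := \dim (limg (hpow u n)).
(* Only positive powers are compared, so that surjectivity of v passes to its outer factor u. *)
have Q0 : exists k, `[< exists n, r n.+1 = k >] by eexists; apply/asboolP; exists 0%N.
case: (ex_minnP Q0) => k /asboolP[n rn] kmin.
pose v := hpow u n.+1; have vE x : v x = iter n.+1 u x by exact: hpowE.
have vv x : exists y, v (v y) = v x.
  have sub : (limg (comp_hom v v) <= limg v)%VS.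
    by apply/subvP=> _ /memv_imgP[y _ ->]; rewrite comp_homE memv_img ?memvf.
  have e : limg (comp_hom v v) = limg v.
    apply/eqP; rewrite eqEdim sub /= [X in (X <= _)%N]rn; apply: kmin.
    apply/asboolP; exists (n.+1 + n)%N; rewrite /r.
    suff -> : hpow u (n.+1 + n).+1 = comp_hom v v by [].
    by apply: hom_ext => y; rewrite hpowE comp_homE !vE -iterD addnS.
  have : v x \in limg (comp_hom v v) by rewrite e memv_img ?memvf.
  by case/memv_imgP=> y _ ->; exists y; rewrite comp_homE.
have [Y [s [i [ss ii siE]]]] := ex_img v.
have tis : msurj (comp_hom s i).
  move=> y; have [x <-] := ss y; have [z zE] := vv x; exists (s z).
  by apply: (minj_inj ii); rewrite comp_homE !siE.
have [t [tK _]] := bij_inv (msurj_dim_inj tis (leqnn _)) tis.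
have rK y : comp_hom t s (i y) = y by rewrite comp_homE -(comp_homE s) tK.
have [Z [g ig]] := ex_complement rK.
have [|] := Xi _ _ (split_iso ig rK); rewrite nonzeroP => /contrapT Z0; [right|left].
  by exists n.+1 => x; rewrite -vE -siE (Z0 (s x)) hom0.
have us : msurj u.
  move=> y; have [_ ik _] := ig; have /ik[z <-] : g y = 0 by apply: Z0.
  have [x <-] := ss z; exists (hpow u n x).
  by rewrite siE vE hpowE.
by split=> //; apply: msurj_dim_inj.
Qed.

(** If u is nilpotent and v x = 0, then u x = x, so x = u^n x = 0; hence v is injective. *)
Lemma indecomposable_local X (u v : modhom X X) : indecomposable X ->
  (forall x, u x + v x = x) -> (minj u /\ msurj u) \/ (minj v /\ msurj v).
Proof.
move=> Xi uv; have [|[n un]] := fitting u Xi; [by left|right].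
have vi : minj v.
  move=> x vx; have ux : u x = x by rewrite -[RHS](uv x) vx addr0.
  by rewrite -(un x); elim: n {un} => //= n <-.
by split=> //; apply: minj_dim_surj vi _.
Qed.

Definition split_epi Y X (f : modhom Y X) := exists s : modhom X Y, forall x, f (s x) = x.
Definition split_mono X Y (f : modhom X Y) := exists r : modhom Y X, forall x, r (f x) = x.

Lemma split_epi_comp Y Y' X (f : modhom Y X) (g : modhom Y' Y) :
  minj (comp_hom f g) -> msurj (comp_hom f g) -> split_epi f.
Proof.
move=> fi fs; have [h [_ hK]] := bij_inv fi fs; exists (comp_hom g h) => x.
by rewrite comp_homE -[RHS]hK comp_homE.
Qed.

(** A section of f writes the identity of X as a sum of two endomorphisms, one through each summand;
    one of them is invertible. *)
Lemma nonsplit_copair X Y1 Y2 (f1 : modhom Y1 X) (f2 : modhom Y2 X)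
    (f : modhom (dsum Y1 Y2) X) :
  indecomposable X -> (forall x y, f (x, y) = f1 x + f2 y) ->
  split_epi f -> split_epi f1 \/ split_epi f2.
Proof.
move=> Xi fE [s sE].
have [] := @indecomposable_local _ (comp_hom f1 (comp_hom (pr1 _ _) s))
  (comp_hom f2 (comp_hom (pr2 _ _) s)) Xi.
- move=> x; rewrite !comp_homE pr1E pr2E -[RHS]sE; case: (s x) => y z /=.
  by rewrite fE.
- by case=> ui us; left; apply: split_epi_comp us.
by case=> ui us; right; apply: split_epi_comp us.
Qed.

End Indecomposables.

(** * Finite direct sums and isomorphism classes *)

Section ModuleLists.
Local Open Scope ring_scope.
Variables (K : fieldType) (A : falgType K).
Implicit Types (M N X Y Z W : fdmod A) (s t : seq (fdmod A)) (Q : fdmod A -> Prop).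

Definition dsums s := foldr (@dsum K A) (zero_mod A) s.

Fixpoint all_of Q s := if s is x :: s' then Q x /\ all_of Q s' else True.
Fixpoint any_of Q s := if s is x :: s' then Q x \/ any_of Q s' else False.

Lemma all_of_cat Q s t : all_of Q (s ++ t) <-> all_of Q s /\ all_of Q t.
Proof. by elim: s => [|x s IH] /=; [split=> // -[]|rewrite IH; split=> [[? []]|[[]]]]. Qed.

Lemma any_of_cat Q s t : any_of Q (s ++ t) <-> any_of Q s \/ any_of Q t.
Proof. by elim: s => [|x s IH] /=; [split=> [|[]//]; right|rewrite IH orA]. Qed.

Lemma all_of_sub Q Q' s : (forall x, Q x -> Q' x) -> all_of Q s -> all_of Q' s.
Proof. by move=> QQ'; elim: s => //= x s IH [/QQ' ? /IH]. Qed.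

Lemma all_of_and Q Q' s : all_of Q s -> all_of Q' s -> all_of (fun x => Q x /\ Q' x) s.
Proof. by elim: s => //= x s IH [? ?] [? ?]; split=> //; apply: IH. Qed.

Lemma all_of_not Q s : ~ any_of Q s -> all_of (fun x => ~ Q x) s.
Proof. by elim: s => //= x s IH /not_orP[? /IH]. Qed.

Lemma any_of_split Q s : any_of Q s -> exists s1 y s2, s = s1 ++ y :: s2 /\ Q y.
Proof.
elim: s => //= x s IH [Qx|/IH[s1 [y [s2 [-> Qy]]]]]; first by exists [::], x, s.
by exists (x :: s1), y, s2.
Qed.

Lemma all_of_nth Q s k : all_of Q s -> (k < size s)%N -> Q (nth (zero_mod A) s k).
Proof. by elim: s k => //= x s IH [|k] /= [Qx Qs] //; apply: IH. Qed.

Lemma any_of_nth Q s k : Q (nth (zero_mod A) s k) -> (k < size s)%N -> any_of Q s.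
Proof. by elim: s k => //= x s IH [|k] /= H ks; [left|right; apply: (IH k)]. Qed.

Lemma dsum_iso X X' Y Y' : iso X X' -> iso Y Y' -> iso (dsum X Y) (dsum X' Y').
Proof.
move=> /iso_bij[f [fi fs]] /iso_bij[g [gi gs]]; have [h hE] := ex_dmap f g.
apply: (@bij_iso _ _ _ _ h) => [[x y]|[x y]].
  by rewrite hE => -[/fi-> /gi->].
by have [z <-] := fs x; have [w <-] := gs y; exists (z, w); rewrite hE.
Qed.

Lemma dsumA X Y Z : iso (dsum X (dsum Y Z)) (dsum (dsum X Y) Z).
Proof.
have [u uE] := ex_pair (pr1 X (dsum Y Z)) (comp_hom (pr1 Y Z) (pr2 X (dsum Y Z))).
have [h hE] := ex_pair u (comp_hom (pr2 Y Z) (pr2 X (dsum Y Z))).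
have {}hE x y z : h (x, (y, z)) = ((x, y), z).
  by rewrite hE uE !comp_homE !pr1E !pr2E.
apply: (@bij_iso _ _ _ _ h) => [[x [y z]]|[[x y] z]]; last by exists (x, (y, z)).
by rewrite hE => -[-> -> ->].
Qed.

Lemma dsum0m X Z : is_zero Z -> iso X (dsum Z X).
Proof. by move=> Z0; apply: iso_sym; exact: ses_zero_l (ses_dsum Z X) Z0. Qed.

Lemma dsumm0 X Z : is_zero Z -> iso X (dsum X Z).
Proof. by move=> Z0; exact: ses_zero_r (ses_dsum X Z) Z0. Qed.

Lemma dsumCA X Y Z : iso (dsum X (dsum Y Z)) (dsum Y (dsum X Z)).
Proof.
apply: (iso_trans (dsumA _ _ _)); apply: iso_trans (iso_sym (dsumA _ _ _)).
by apply: dsum_iso (dsumC _ _) (iso_refl _).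
Qed.

Lemma dsums_cat s t : iso (dsums (s ++ t)) (dsum (dsums s) (dsums t)).
Proof.
elim: s => [|x s IH] /=; first exact: dsum0m (@zero_mod_zero _ A).
exact: iso_trans (dsum_iso (iso_refl x) IH) (dsumA _ _ _).
Qed.

Lemma dsums_pick s y t : iso (dsums (s ++ y :: t)) (dsum y (dsums (s ++ t))).
Proof.
elim: s => [|x s IH] /=; first exact: iso_refl.
exact: iso_trans (dsum_iso (iso_refl x) IH) (dsumCA _ _ _).
Qed.

Lemma dsums_retract s :
  all_of (fun x => exists (i : modhom x (dsums s)) (r : modhom (dsums s) x),
    forall y, r (i y) = y) s.
Proof.
elim: s => [//|x s IH]; rewrite -[dsums (x :: s)]/(dsum x (dsums s)); split.
  by exists (ds1 _ _), (pr1 _ _) => y; rewrite pr1E ds1E.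
apply: all_of_sub IH => y [i [r rK]].
exists (comp_hom (ds2 _ _) i), (comp_hom r (pr2 _ _)) => z.
by rewrite !comp_homE pr2E ds2E rK.
Qed.

Definition kills (a : A) M := forall x, act M a x = 0.

Lemma kills_iso a M N : iso M N -> kills a M -> kills a N.
Proof.
by case/iso_bij=> f [_ fs] aM y; have [x <-] := fs y; rewrite -homP aM hom0.
Qed.

Lemma kills_dsums a s : kills a (dsums s) <-> all_of (kills a) s.
Proof.
elim: s => [|x s IH]; first by split=> // _ y; apply: zero_mod_zero.
rewrite -[dsums (x :: s)]/(dsum x (dsums s)) -[all_of _ _]/(kills a x /\ all_of (kills a) s) -IH; split=> [H|[Hx Hs] [y z]]; last by rewrite dsE Hx Hs.
by split=> y; [have := H (y, 0) | have := H (0, y)]; rewrite dsE => -[].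
Qed.

Fixpoint pairwise_noniso s :=
  if s is x :: s' then ~ any_of (iso x) s' /\ pairwise_noniso s' else True.

Lemma ex_iso_representatives s : exists t,
  [/\ pairwise_noniso t, all_of (fun x => any_of (iso x) t) s &
      forall Q, all_of Q s -> all_of Q t].
Proof.
elim: s => [|x s [t [tn st tQ]]]; first by exists [::].
have [xt|xt] := pselect (any_of (iso x) t).
  by exists t; split=> // Q [_ /tQ].
exists (x :: t); split=> //=; last by move=> Q [Qx /tQ].
split; first by left; apply: iso_refl.
by apply: all_of_sub st => y; right.
Qed.

Lemma pairwise_noniso_nth s i j : pairwise_noniso s -> (i < size s)%N -> (j < size s)%N ->
  iso (nth (zero_mod A) s i) (nth (zero_mod A) s j) -> i = j.
Proof.
elim: s i j => //= x s IH [|i] [|j] //= [xs sn].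
- by move=> _ js xj; case: xs; exact: any_of_nth xj js.
- by move=> is_ _ /iso_sym xj; case: xs; exact: any_of_nth xj is_.
by move=> is_ js ij; congr _.+1; apply: IH.
Qed.

(** Once a copy of x is removed from t, the remaining members of s still occur there, since none of
    them is isomorphic to x. *)
Lemma dsums_summand s t : pairwise_noniso s -> all_of (fun x => any_of (iso x) t) s ->
  direct_summand (dsums s) (dsums t).
Proof.
elim: s t => [|x s IH] t /=.
  by move=> _ _; exists (dsums t); apply: dsum0m (@zero_mod_zero _ A).
move=> [xs sn] [/any_of_split[t1 [y [t2 [-> xy]]]] st].
have [|X sX] := IH (t1 ++ t2) sn.
  apply: all_of_sub (all_of_and (all_of_not xs) st) => z [xz] /any_of_cat[zt|[zy|zt]].
  - by apply/any_of_cat; left.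
  - by case: xz; apply: iso_trans xy (iso_sym zy).
  by apply/any_of_cat; right.
exists X; apply: (iso_trans (dsums_pick _ _ _)); apply: iso_trans (dsumA _ _ _).
exact: dsum_iso (iso_sym xy) sX.
Qed.

Lemma dsums_bigE s :
  dsums s = \big[@dsum K A/@zero_mod K A]_(i < size s) nth (zero_mod A) s i.
Proof.
rewrite -(big_mkord xpredT (nth (zero_mod A) s)) -(big_nth (zero_mod A) xpredT id).
by elim: s => [|x s IH] /=; rewrite ?big_nil // big_cons IH.
Qed.

(** The dimensions add up to force both complements to be zero. *)
Lemma direct_summand_iso M N : direct_summand M N -> direct_summand N M -> iso M N.
Proof.
move=> [X NX] [Y MY]; apply: iso_trans (iso_sym NX); apply: dsumm0; apply/mdim0/eqP.
move: (mdim_iso MY); rewrite mdim_dsum (mdim_iso NX) mdim_dsum -addnA => /eqP.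
by rewrite -{1}[mdim M]addn0 eqn_add2l eq_sym addn_eq0 => /andP[].
Qed.

End ModuleLists.

(** * Faithful tilting modules *)

Section FaithfulTilting.
Local Open Scope ring_scope.
Variables (K : fieldType) (A : falgType K).
Variables (d : Order.disp_t) (Lam : finPOrderType d).
Variable L : Lam -> fdmod A.
Hypothesis hL : simples_representatives L.
Variables (P : Lam -> fdmod A) (p : forall l, modhom (P l) (L l)).
Hypothesis hP : forall l, projective_cover (p l).
Hypothesis hqh : quasi_hereditary p.
Variables (D : cofunctor A) (hD : simple_preserving_duality D).
Implicit Types M N T X Y Z W : fdmod A.

Local Notation Delta := (std P).
Local Notation wt := (wt P).
Local Notation FD := (FD P).
Local Notation tilt := (tilt P D).

Lemma tilt_zero Z : is_zero Z -> tilt Z.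
Proof. by move=> Z0; split; apply: filt_zero => //; apply: (dual_is_zero hD). Qed.

Lemma ex_tilt_decomposition M : tilt M ->
  exists s, iso M (dsums s) /\ all_of (fun X => indecomposable X /\ tilt X) s.
Proof.
have [n] := ubnP (mdim M); elim: n M => // n IH M dM tM.
have [M0|M0] := pselect (is_zero M).
  by exists [::]; split=> //; apply: is_zero_iso (@zero_mod_zero _ A).
have [iM|nM] := pselect (indecomposable M).
  by exists [:: M]; split=> //; exact: dsumm0 (@zero_mod_zero _ A).
have [X [Y [MXY [X0 Y0]]]] : exists X Y, iso M (dsum X Y) /\ ~ is_zero X /\ ~ is_zero Y.
  apply: contrapT => H; apply: nM; split; first exact/nonzeroP.
  move=> X Y MXY; apply: contrapT => /not_orP[/contrapT/nonzeroP X0 /contrapT/nonzeroP Y0].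
  by apply: H; exists X, Y.
have dXY : (mdim X + mdim Y < n.+1)%N by rewrite -mdim_dsum -(mdim_iso MXY).
have [dX dY] : (0 < mdim X)%N /\ (0 < mdim Y)%N.
  by split; rewrite lt0n; apply/eqP=> /mdim0.
have tXY := tilt_iso MXY tM.
have [||s [Xs es]] := IH X.
- by rewrite -ltnS; apply: leq_trans dXY; rewrite ltnS -{1}[mdim X]addn0 ltn_add2l.
- exact: (tilt_summand hL hP hqh hD tXY).
have [||t [Yt et]] := IH Y.
- by rewrite -ltnS; apply: leq_trans dXY; rewrite ltnS -{1}[mdim Y]add0n ltn_add2r.
- exact: (tilt_summand hL hP hqh hD (tilt_iso (dsumC X Y) tXY)).
exists (s ++ t); split; last exact/all_of_cat.
apply: (iso_trans MXY); apply: iso_trans (iso_sym (dsums_cat s t)).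
exact: dsum_iso.
Qed.

Lemma dual_indecomposable X : indecomposable X -> indecomposable (D X).
Proof.
move=> [/nonzeroP X0 Xi]; split; first by apply/nonzeroP=> /(dual_is_zeroV hD).
move=> Y Z DXYZ.
have XYZ : iso X (dsum (D Z) (D Y)).
  apply: (iso_trans (bidual_iso hD X)); apply: (iso_trans (dual_iso D DXYZ)).
  exact: dual_dsum.
have [|] := Xi _ _ XYZ; rewrite nonzeroP => /contrapT/(dual_is_zeroV hD) z; [right|left];
  by rewrite nonzeroP => /(_ z).
Qed.

(* For a maximal weight l, [Delta l] embeds in X and in [D X] with cokernels in
   F(Delta), so both embeddings extend, to maps X -> D X -> X whose composite is not
   nilpotent. *)
Lemma tilt_self_dual X : indecomposable X -> tilt X -> iso X (D X).
Proof.
move=> Xi tX; have [/nonzeroP X0 _] := Xi.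
have [l [lX lmax]] := ex_maxwt hL hP X0.
have lDX : wt l (D X) by apply: (wt_dual hL hP hD).
have lmaxD : maxwt P l (D X) by move=> m lm /(wt_dualV hL hP hD); apply: lmax.
have tDX := tilt_dual hD tX.
have [a [x ax]] := wt_std_hom lX lmax; have [b [y by_]] := wt_std_hom lDX lmaxD.
have [ai aQ] := FD_max_hom hL hP hqh tX.1 lmax ax.
have [bi bQ] := FD_max_hom hL hP hqh tDX.1 lmaxD by_.
have [C [c ac]] := ses_coker ai; have [C' [c' bc]] := ses_coker bi.
have [h hE] : exists h : modhom X (D X), forall z, h (a z) = b z.
  apply: (XV_FD hL hP hqh hD _ tDX.2 ac b).
  by case: ac => _ ? ?; apply: (aQ C c).
have [k kE] : exists k : modhom (D X) X, forall z, k (b z) = a z.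
  apply: (XV_FD hL hP hqh hD _ tX.2 bc a).
  by case: bc => _ ? ?; apply: (bQ C' c').
have kha z : comp_hom k h (a z) = a z by rewrite comp_homE hE kE.
have [[ui us]|[n un]] := fitting (comp_hom k h) Xi; last first.
  by case: ax; rewrite -(un (a x)); elim: n {un} => //= n <-; rewrite kha.
have [v [vK _]] := bij_inv ui us.
apply: (indecomposable_retract (f := h) (r := comp_hom v k) X0).
  exact: dual_indecomposable.
by move=> z; rewrite comp_homE -(comp_homE k) vK.
Qed.

(** By [nonsplit_copair], two non-split maps combine to a non-split map from the direct sum; hence
    one with image of maximal dimension contains all other images. *)
Lemma ex_max_nonsplit X : indecomposable X -> exists Y (f : modhom Y X),
  [/\ tilt Y, ~ split_epi f & forall Y' (f' : modhom Y' X), tilt Y' -> ~ split_epi f' ->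
      forall y', exists y, f y = f' y'].
Proof.
move=> Xi; have [/nonzeroP X0 _] := Xi.
pose Q n := `[< exists Y (f : modhom Y X), [/\ tilt Y, ~ split_epi f & \dim (limg f) = n] >].
have Q0 : exists n, Q n.
  exists (\dim (limg (hom_zero (zero_mod A) X))); apply/asboolP.
  exists (zero_mod A), (hom_zero _ _); split=> //; first exact/tilt_zero/zero_mod_zero.
  by case=> s sK; apply: X0 => x; rewrite -(sK x) hom_zeroE.
have Qb n : Q n -> (n <= \dim (fullv : {vspace X}))%N.
  by move=> /asboolP[Y [f [_ _ <-]]]; apply/dimvS/subvf.
case: (ex_maxnP Q0 Qb) => n /asboolP[Y [f [tY fns fn]]] nmax.
exists Y, f; split=> // Y' f' tY' fns' y'.
have [g gE] := ex_copair f f'.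
have sub : (limg f <= limg g)%VS.
  apply/subvP=> _ /memv_imgP[y _ ->]; have -> : f y = g (y, 0) by rewrite gE hom0 addr0.
  by rewrite memv_img ?memvf.
have /eqP e : limg f == limg g.
  rewrite eqEdim sub fn; apply: nmax; apply/asboolP; exists (dsum Y Y'), g; split=> //.
    exact: tilt_dsum.
  by move/(nonsplit_copair Xi gE)=> [].
have : f' y' \in limg f.
  by rewrite e; have -> : f' y' = g (0, y') by [rewrite gE hom0 add0r]; rewrite memv_img ?memvf.
by case/memv_imgP=> y _ ->; exists y.
Qed.

(** Let Q be the cokernel of f. The element t is the image of a nonzero element of D Q in D X,
    transported to X by self-duality. A non-split mono g gives a non-split map D Z -> D X -> X,
    which lands in the image of f and so dies in Q; dualising back, g kills t. *)
Lemma ex_common_kernel X Y (f : modhom Y X) : indecomposable X -> tilt X -> ~ msurj f ->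
  (forall Y' (f' : modhom Y' X), tilt Y' -> ~ split_epi f' ->
      forall y', exists y, f y = f' y') ->
  exists2 t : X, t <> 0 &
    forall Z (g : modhom X Z), tilt Z -> ~ split_mono g -> g t = 0.
Proof.
move=> Xi tX nf fmax; have /isoP[th [th' [thK thK']]] := tilt_self_dual Xi tX.
have [eta [etab etaN]] := ex_bidual hD.
have [Q [q [qs qk]]] := ex_coker f.
have [z z0] : exists z : D Q, z <> 0.
  apply: not_is_zero => /(dual_is_zeroV hD) Q0; apply: nf => x.
  exact/qk/Q0.
have [t tE] := (etab X).2 (cmap D th' (cmap D q z)); exists t.
  move=> t0; apply: z0; apply: (dual_surj hD qs).
  have th's : msurj th' by move=> x; exists (th x).
  by apply: (dual_surj hD th's); rewrite -tE t0 hom0.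
move=> Z g tZ gns; apply: (etab Z).1; rewrite etaN tE.
(* By fullness a section of this map is, up to the isomorphism [th'], of the form D r; faithfulness
   makes r a retraction of g. *)
have fns : ~ split_epi (comp_hom th' (cmap D g)).
  case=> s sE; apply: gns; have [r rE] := dual_full hD (comp_hom s th').
  exists r => x; rewrite -comp_homE -[RHS]id_homE; apply: (dual_faithful hD) => y.
  rewrite cmap_comp comp_homE rE cmap_id id_homE comp_homE.
  by rewrite -[LHS]thK' -(comp_homE th') sE thK'.
rewrite -(comp_homE (cmap D (cmap D g))) -cmap_comp -comp_homE -cmap_comp.
apply: (dual_zero hD) => y; rewrite !comp_homE; apply/qk.
by have [w wE] := fmax _ _ (tilt_dual hD tZ) fns y; exists w; rewrite wE comp_homE.
Qed.

(* The cokernel of f is only required to embed in a tilting module, a condition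
   inherited by a complement of a summand of T on which f vanishes. *)
Definition tilt_copresentation T (f : modhom (regmod A) T) :=
  [/\ tilt T, minj f,
      forall Y, tilt Y -> forall h : modhom (regmod A) Y,
        exists h' : modhom T Y, forall a, h' (f a) = h a &
      exists T1 (g : modhom T T1), tilt T1 /\ kerim f g].

(** The cokernel C of A -> T lies in F(Delta). This gives Ext^1(C, Y) = 0 for tilting Y, hence the
    extension property, and also an embedding of C in a tilting module. *)
Lemma ex_tilt_copresentation : exists T (f : modhom (regmod A) T), tilt_copresentation f.
Proof.
have [T [C [f [c [fc FC tT]]]]] := ex_tilt_embedding hL hP hqh hD (regmod_FD hL hP hqh).
have [T1 [C1 [a [c1 [[ai _ _] _ tT1]]]]] := ex_tilt_embedding hL hP hqh hD FC.
have [fi fk _] := fc.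
exists T, f; split=> //.
  move=> Y tY; exact: (XV_FD hL hP hqh hD FC tY.2 fc).
exists T1, (comp_hom a c); split=> // y; rewrite comp_homE -fk.
by split=> [/ai|->]; rewrite ?hom0.
Qed.

(** If r vanished on the image of f, that image would lie in the kernel of r, a summand of T with a
    copresentation of smaller dimension. *)
Lemma ex_minimal_copresentation : exists T (f : modhom (regmod A) T),
  tilt_copresentation f /\
  forall X (i : modhom X T) (r : modhom T X),
    ~ is_zero X -> (forall x, r (i x) = x) -> exists a, r (f a) <> 0.
Proof.
pose Q n := `[< exists T (f : modhom (regmod A) T), tilt_copresentation f /\ mdim T = n >].
have Q0 : exists n, Q n.
  have [T [f tf]] := ex_tilt_copresentation.
  by exists (mdim T); apply/asboolP; exists T, f.
case: (ex_minnP Q0) => n /asboolP[T [f [[tT fi fext [T1 [g [tT1 fg]]]] dT]]] nmin.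
exists T, f; split=> [|X i r X0 rK]; first by split=> //; exists T1, g.
apply: contrapT => /forallNP rf; have {}rf a : r (f a) = 0 by apply: contrapT (rf a).
have [T' [j jr]] : exists T' (j : modhom T' T), ses j r by apply: ses_ker => x; exists (i x).
have [ji jk rs] := jr; have [t tK] := ses_retract jr rK.
have [a|f' f'E] := factor_inj (h := f) ji; first exact/jk/rf.
have /nmin : Q (mdim T').
  apply/asboolP; exists T', f'; split=> //; split.
  - exact: (tilt_summand hL hP hqh hD (tilt_iso (split_iso jr tK) tT)).
  - by move=> a f'a; apply: fi; rewrite -f'E f'a hom0.
  - move=> Y tY h; have [h' h'E] := fext _ tY h.
    by exists (comp_hom h' j) => a; rewrite comp_homE f'E h'E.
  exists T1, (comp_hom g j); split=> // y; rewrite comp_homE fg.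
  split=> -[a]; first by rewrite -f'E => /(minj_inj ji) <-; exists a.
  by move=> <-; exists a; rewrite f'E.
rewrite -dT (mdim_ses jr) -{2}[mdim T']addn0 leq_add2l leqn0 => /eqP/mdim0.
by [].
Qed.

Lemma ex_killer T (f : modhom (regmod A) T) X (i : modhom X T) (r : modhom T X) :
  tilt_copresentation f ->
  (forall X (i : modhom X T) (r : modhom T X),
    ~ is_zero X -> (forall x, r (i x) = x) -> exists a, r (f a) <> 0) ->
  indecomposable X -> tilt X -> (forall x, r (i x) = x) ->
  exists2 a : A, a <> 0 &
    forall Y, indecomposable Y -> tilt Y -> ~ iso X Y -> kills a Y.
Proof.
move=> [tT fi fext [T1 [g [tT1 fg]]]] Tmin Xi tX rK.
have [/nonzeroP X0 _] := Xi.
have nosplit (r' : modhom T X) : (forall a, r' (f a) = 0) -> ~ split_epi r'.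
  by move=> rf [i' iK]; have [a] := Tmin X i' r' X0 iK; apply.
have [Y [psi [tY psins psimax]]] := ex_max_nonsplit Xi.
have npsi : ~ msurj psi.
  move=> ps; have [y yE] := ps (r (f (1 : A))).
  have [h hE] := ex_orbit_hom y; have [h' h'E] := fext _ tY h.
  have uv x : comp_hom psi (comp_hom h' i) x
      + comp_hom (hom_sub r (comp_hom psi h')) i x = x.
    by rewrite !comp_homE hom_subE comp_homE rK addrCA subrr addr0.
  have [[ui us]|[vi vs]] := indecomposable_local Xi uv.
    exact/psins/(split_epi_comp ui us).
  apply: (@nosplit (hom_sub r (comp_hom psi h'))); last exact: split_epi_comp vi vs.
  move=> a; rewrite hom_subE comp_homE h'E hE homP yE -!homP regmod_actE mulr1.
  by rewrite subrr.
have [t t0 tk] := ex_common_kernel Xi tX npsi psimax.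
have /fg[a aE] : g (i t) = 0.
  rewrite -comp_homE; apply: tk => // -[r' r'K].
  apply: (@nosplit (comp_hom r' g)) => [a|].
    by rewrite comp_homE (ses_comp0 _ fg) hom0.
  by exists i => x; rewrite comp_homE -(comp_homE g) r'K.
exists a => [a0|Z Zi tZ XZ z].
  by apply: t0; rewrite -[t]rK -aE a0 !hom0.
have [h hE] := ex_orbit_hom z; have [h' h'E] := fext _ tZ h.
rewrite -hE -h'E aE -comp_homE; apply: tk => // -[r' r'K].
exact/XZ/(indecomposable_retract X0 Zi r'K).
Qed.

Lemma ex_minimal_faithful_tilt : exists s,
  [/\ all_of (fun X => indecomposable X /\ tilt X) s, pairwise_noniso s,
      faithful (dsums s) &
      forall T', tilt T' -> faithful T' -> direct_summand (dsums s) T'].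
Proof.
have [T [f [cop Tmin]]] := ex_minimal_copresentation.
have [tT fi _ _] := cop; have [s [Ts es]] := ex_tilt_decomposition tT.
have [k [/= kn sk kQ]] := ex_iso_representatives s.
have killer : all_of (fun X => exists2 a : A, a <> 0 &
    forall Y, indecomposable Y -> tilt Y -> ~ iso X Y -> kills a Y) s.
  have /isoP[u [v [uK vK]]] := Ts.
  apply: all_of_sub (all_of_and es (dsums_retract s)) => X [[Xi tX] [i [r rK]]].
  apply: (ex_killer (i := comp_hom v i) (r := comp_hom r u) cop Tmin) => // x.
  by rewrite !comp_homE vK rK.
exists k; split=> //; first exact: kQ.
  move=> a ka; have {}ka : all_of (kills a) k by apply/kills_dsums.
  have sa : all_of (kills a) s.
    apply: all_of_sub sk => x /any_of_split[k1 [y [k2 [kE xy]]]].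
    move: ka; rewrite kE => /all_of_cat[_ [ya _]].
    exact: kills_iso (iso_sym xy) ya.
  have Ta : kills a T by apply: kills_iso (iso_sym Ts) _; apply/kills_dsums.
  have : f (a : regmod A) = 0 by rewrite -[a in LHS]mulr1 -regmod_actE homP Ta.
  exact: fi.
move=> T' tT' fT'; have [t [Tt et]] := ex_tilt_decomposition tT'.
have kt : all_of (fun x => any_of (iso x) t) k.
  apply: kQ; apply: all_of_sub killer => X [a a0 ka]; apply: contrapT => nX.
  apply: a0; apply: fT'; apply: (kills_iso (iso_sym Tt)); apply/kills_dsums.
  by apply: all_of_sub (all_of_and et (all_of_not nX)) => Y [[Yi tY] /(ka _ Yi tY)].
have [X tX] := dsums_summand kn kt; exists X; exact: iso_trans Tt tX.
Qed.

Lemma tilt_dsums s : all_of (fun X => indecomposable X /\ tilt X) s -> tilt (dsums s).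
Proof.
elim: s => [_|x s IH [[_ tx] /IH ts]]; first exact/tilt_zero/zero_mod_zero.
exact: tilt_dsum.
Qed.

End FaithfulTilting.

Theorem corollary3p15 (K : fieldType) (A : falgType K)
    (d : Order.disp_t) (Lam : finPOrderType d)
    (L : Lam -> fdmod A)
    (hL : simples_representatives L) (hsplit : split_simples L)
    (P : Lam -> fdmod A) (p : forall l, modhom (P l) (L l))
    (hP : forall l, projective_cover (p l))
    (I : Lam -> fdmod A) (i : forall l, modhom (L l) (I l))
    (hI : forall l, injective_hull (i l))
    (hqh : quasi_hereditary p)
    (N : forall l, submod (I l))
    (hN : forall l, is_costd L l (N l))
    (D : cofunctor A) (hD : simple_preserving_duality D) :
  exists T : fdmod A,
    minimal_faithful_basic_tilting (std P) (fun l => submod_mod (N l)) T /\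
    forall T' : fdmod A,
      minimal_faithful_basic_tilting (std P) (fun l => submod_mod (N l)) T' ->
      iso T' T.
Proof.
have tP M : tilting (std P) (fun l => submod_mod (N l)) M <-> tilt P D M.
  exact: (tiltingP hL hP hqh hD hI hN M).
have [s [es sn sf smin]] := ex_minimal_faithful_tilt hL hP hqh hD.
have ts := tilt_dsums hD es.
exists (dsums s); split=> [|T' [_ tT' fT' minT']]; last first.
  apply: direct_summand_iso; first by apply: minT' => //; apply/tP.
  by apply: smin => //; apply/tP.
split=> //; [|exact/tP|by move=> T' /tP; apply: smin].
exists (size s), (fun k => nth (zero_mod A) s k); split.
- rewrite -dsums_bigE; exact: iso_refl.
- by move=> k; have [? ?] := all_of_nth es (ltn_ord k); split=> //; apply/tP.
by move=> j k jk; apply/val_inj/(pairwise_noniso_nth sn (ltn_ord j) (ltn_ord k) jk).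
Qed.
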